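(* Let $c'_i=\sum_{j=0}^sC_{ji}c_j$ for $0\le i\le s$, for some constant matrix $C\in GL_{s+1}\mathbf C$. Let $\hat c'_i=\sum_{j=0}^s(Q_0')^{-1}_{ji}c'_j$, where the matrix function $Q'_0$ is obtained from the basis $P_i'=\sum_{j=0}^sC_{ji}P_j$ of the quantum Toda $D^h$-module $M^h$ of $G/B$ in the same way as the matrix function $Q_0$ is obtained from the basis $P_0,\dots,P_s$ (see the context). Then $$\hat c'_i=\sum_{k=0}^sR_{ki}c_k\quad(0\le i\le s),\qquad\text{where } R=C(Q'_0)^{-1}=Q_0^{-1}C.$$
   Context: $G$ is a complex semisimple Lie group of rank $r$, $B$ a Borel subgroup, $s+1=\dim_{\mathbf C} H^*(G/B;\mathbf C)$. Write $H^*G/B=\mathbf C[b_1,\dots,b_r]/(R_1,\dots,R_u)$, where $b_1,\dots,b_r$ is the basis of $H^2G/B$ corresponding to the fundamental weights and (with $u=r$) $R_1,\dots,R_u$ are homogeneous generators of the Weyl-group-invariant polynomials of positive degree (these polynomials $R_i$ are unrelated to the matrix $R$ in the claim). Quantum Toda module: put $q_i=e^{t_i}$, $\partial_i=\partial/\partial t_i=q_i\,\partial/\partial q_i$, and let $D^h$ be the algebra of differential operators generated by $h\partial_1,\dots,h\partial_r$ with coefficients in $\mathbf C[q_1,\dots,q_r,h]$ ($h$ a complex parameter), graded by $\deg h\partial_i=2$, $\deg q_i=4$, $\deg h=2$. Let $H=\sum_{i,j}(\alpha_i^\vee,\alpha_j^\vee)h\partial_i\,h\partial_j-\sum_i(\alpha_i^\vee,\alpha_i^\vee)q_i$,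 where $\alpha_i^\vee$ are the simple coroots and $(\ ,\ )$ is a Weyl-invariant inner product. $D_i^h\in D^h$ is the unique homogeneous operator commuting with $H$ whose restriction to $q=0$ (coefficients written on the left) is $R_i(h\partial_1,\dots,h\partial_r)$. $M^h=D^h/(D_1^h,\dots,D_u^h)$ (quotient by the left ideal) is known to be free over $\mathbf C[q_1,\dots,q_r,h]$ of rank $s+1$. $P_0=1,P_1,\dots,P_s$ are the standard monomials in $h\partial_1,\dots,h\partial_r$ with respect to a choice of Gröbner basis of the ideal $(D_1^h,\dots,D_u^h)$, listed in nondecreasing degree; $[P_0],\dots,[P_s]$ is a basis of $M^h$ over $\mathbf C[q_1,\dots,q_r,h]$. $c_i$ is the monomial in $b_1,\dots,b_r$ obtained from $P_i$ by replacing each $h\partial_j$ by $b_j$. Construction of $Q_0$: define $\Omega_i$ by $[h\partial_iP_j]=\sum_k(h\Omega_i)_{kj}[P_k]$ and $\Omega=\sum_i\Omega_i\,dt_i$ (a flat connection form for every $h$). With $|h|=1$, write $\Omega=L^{-1}dL$ with $L=L(q,h)$ a map to the smooth loop group of $GL_{s+1}\mathbf C$; $L$ is determined up to left multiplication by a constant loop. Let $L=L_-L_+$ be the (local) Birkhoff factorization, with $L_-=I+O(h^{-1})$ a series in $h^{-1}$ and $L_+=Q_0(q)+O(h)$ a series in $h$. $L$ is chosen so that $L_+$ is polynomial in $q_1,\dots,q_r,h$ with $L_+|_{q=0}=I$; this is possible and determines $L_+$ uniquely. Thus $Q_0=L_+|_{h=0}$. Construction of $Q_0'$: the same with $P_i'$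 in place of $P_i$: $[h\partial_iP'_j]=\sum_k(h\Omega'_i)_{kj}[P'_k]$, $\Omega'=\sum_i\Omega'_idt_i=(L')^{-1}dL'$, $L'=L'_-L'_+$ (Birkhoff factorization), with $L'_+$ polynomial in $q_1,\dots,q_r,h$ and $L'_+|_{q=0}=I$, and $Q_0'=L'_+|_{h=0}$. *)

(* Defs.v *)
(* [mpoly] has to be imported before [all_analysis]: the notations of the two
   clash in the other order. *)
From HB Require Import structures.
From mathcomp Require Import all_boot all_order all_algebra.
From mathcomp Require Import complex mpoly.
From mathcomp Require Import all_classical all_reals all_analysis.
Set Implicit Arguments.
Unset Strict Implicit.
Unset Printing Implicit Defensive.
Import Order.TTheory GRing.Theory Num.Theory.
Import numFieldNormedType.Exports.
Local Open Scope classical_set_scope.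
Local Open Scope ring_scope.

(* The complex numbers.  Seen as a [numClosedFieldType], R[i] inherits the
   topology that MathComp-Analysis puts on every numFieldType; the norm of a
   complex number or matrix is again an element of [Cx R]. *)
Definition Cx (R : realType) : numClosedFieldType := R[i]%C.

Record lieAlgebra (K : fieldType) := LieAlgebra {
  lie_sort :> vectType K;
  lie : lie_sort -> lie_sort -> lie_sort;
  lie_linl : forall y a x x', lie (a *: x + x') y = a *: lie x y + lie x' y;
  lie_linr : forall x a y y', lie x (a *: y + y') = a *: lie x y + lie x y';
  lie_alt : forall x, lie x x = 0;
  lie_jacobi : forall x y z,
    lie x (lie y z) + lie y (lie z x) + lie z (lie x y) = 0 }.

Section Lie.
Variables (K : fieldType) (g : lieAlgebra K).
Implicit Types (U : {vspace g}) (x y t : g) (a : {linear g -> K^o}).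

Definition lie_ideal U := forall x y, y \in U -> lie x y \in U.

Definition lie_abelian U := forall x y, x \in U -> y \in U -> lie x y = 0.

Definition semisimple := forall U, lie_ideal U -> lie_abelian U -> U = 0%VS.

Definition lie_subalgebra U :=
  forall x y, x \in U -> y \in U -> lie x y \in U.

Definition lie_nilpotent U := exists n : nat, forall (s : seq g) y,
  size s = n -> {subset s <= U} -> y \in U -> foldr (@lie _ g) y s = 0.

Definition self_normalizing U :=
  forall x, (forall y, y \in U -> lie x y \in U) -> x \in U.

Definition cartan_subalgebra U :=
  [/\ lie_subalgebra U, lie_nilpotent U & self_normalizing U].

(* Linear functionals on g are only ever used through their values on the
   Cartan subalgebra U. *)
Definition root_vector U a x := forall t, t \in U -> lie t x = a t *: x.

Definition is_root U a :=
  (exists2 t, t \in U & a t != 0) /\ (exists2 x, x != 0 & root_vector U a x).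

Definition simple_system U (r : nat) (al : 'I_r -> {linear g -> K^o}) :=
  [/\ forall i, is_root U (al i),
      forall c : 'I_r -> K,
        (forall t, t \in U -> \sum_i c i * al i t = 0) -> forall i, c i = 0
    & forall a, is_root U a -> exists n : 'I_r -> nat,
        (forall t, t \in U -> a t = \sum_i al i t *+ n i) \/
        (forall t, t \in U -> a t = - \sum_i al i t *+ n i)].

(* The coroot of a is the element of [g_a, g_(-a)] on which a takes the value
   2; the root spaces of a semisimple Lie algebra are lines. *)
Definition is_coroot U a (v : g) :=
  [/\ v \in U, a v = 2%:R &
      exists x y, [/\ root_vector U a x,
        forall t, t \in U -> lie t y = - (a t *: y) & v = lie x y]].

End Lie.

(* The part of the pair (G, B) that enters below: the complex semisimple Lie
   algebra of G, a Cartan subalgebra of it, the simple roots that single out B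
   among the Borel subalgebras containing it, the simple coroots, and a
   Weyl-invariant inner product, i.e. an invariant symmetric bilinear form on
   the Cartan subalgebra that is positive definite on the real span of the
   coroots. *)
Record flagData (R : realType) (r : nat) := FlagData {
  fd_lie :> lieAlgebra (Cx R);
  fd_semisimple : semisimple fd_lie;
  fd_cartan : {vspace fd_lie};
  fd_cartanP : cartan_subalgebra fd_cartan;
  fd_rank : \dim fd_cartan = r;
  sroot : 'I_r -> {linear fd_lie -> (Cx R)^o};
  fd_simple : simple_system fd_cartan sroot;
  coroot : 'I_r -> fd_lie;
  fd_corootP : forall i, is_coroot fd_cartan (sroot i) (coroot i);
  ip : fd_lie -> fd_lie -> Cx R;
  ip_lin : forall a x x' y, x \in fd_cartan -> x' \in fd_cartan ->
    y \in fd_cartan -> ip (a *: x + x') y = a * ip x y + ip x' y;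
  ip_sym : forall x y, x \in fd_cartan -> y \in fd_cartan -> ip x y = ip y x;
  ip_weyl : forall i x y, x \in fd_cartan -> y \in fd_cartan ->
    ip (x - sroot i x *: coroot i) (y - sroot i y *: coroot i) = ip x y;
  ip_pos : forall c : 'I_r -> R, (exists i, c i != 0) ->
    let x := \sum_i (c i)%:C%C *: coroot i in 0 < ip x x }.

Section Cohomology.
Variables (R : realType) (r : nat) (G : flagData R r).
Local Notation C := (Cx R).
Implicit Types p : {mpoly C[r]}.

(* The variable 'X_j is b_j, the j-th fundamental weight.  The i-th simple
   reflection maps it to itself if j != i, and to b_i minus the i-th simple
   root if j = i; a root is the combination of the fundamental weights whose
   coefficients are its values on the simple coroots. *)
Definition weyl_subst (i : 'I_r) : r.-tuple {mpoly C[r]} :=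
  [tuple 'X_j - (if j == i then \sum_k sroot G i (coroot G k) *: 'X_k else 0)
     | j < r].

Definition weyl_invariant p := forall i, p \mPo weyl_subst i = p.

Definition basic_invariants (inv : 'I_r -> {mpoly C[r]}) :=
  [/\ forall i, exists2 d : nat, (0 < d)%N & inv i \is d.-homog,
      forall i, weyl_invariant (inv i)
    & forall p, weyl_invariant p ->
        exists f : {mpoly C[r]}, p = f \mPo [tuple inv i | i < r]].

(* Equality of the classes of p and p' in H^*(G/B) = C[b_1..b_r]/(inv). *)
Definition coh_eq (inv : 'I_r -> {mpoly C[r]}) p p' :=
  exists a : 'I_r -> {mpoly C[r]}, p - p' = \sum_i a i * inv i.

Definition coh_dim (inv : 'I_r -> {mpoly C[r]}) (n : nat) :=
  exists e : 'I_n -> {mpoly C[r]},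
    forall p, exists! a : 'rV[C]_n, coh_eq inv p (\sum_i a 0 i *: e i).

End Cohomology.

(* C[q_1..q_r, h], as polynomials in q over C[h]. *)
Notation coefRing R r := {mpoly {poly Cx R}[r]}.

(* An element of D^h, as a polynomial in the h d_i with coefficients written
   on the left: 'X_i stands for h d_i.  The ring product of this type is not
   the product of D^h, which is composition under [op] below. *)
Notation Dh R r := {mpoly {mpoly {poly Cx R}[r]}[r]}.

Section Toda.
Variables (R : realType) (r : nat).
Local Notation C := (Cx R).
Local Notation A := (coefRing R r).
Local Notation D := (Dh R r).

Definition scalarA (c : C) : A := (c%:P)%:MP.

Definition hd (i : 'I_r) (f : A) : A := ('X : {poly C}) *: ('X_i * f^`M(i)).

Definition hd_mon (n : 'X_{1..r}) : A -> A :=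
  foldr (fun i F => iter (n i) (hd i) \o F) id (enum 'I_r).

(* The differential operator on C[q,h] denoted by P.  No nonzero P denotes the
   zero operator: D^h acts faithfully on C[q,h]. *)
Definition op (P : D) (f : A) : A := \sum_(n <- msupp P) P@_n * hd_mon n f.

(* Grading: deg h d_i = 2, deg q_i = 4, deg h = 2. *)
Definition Dh_homog (d : nat) (P : D) := forall (m n : 'X_{1..r}) (k : nat),
  ((P@_m)@_n)`_k != 0 -> (2 * mdeg m + 4 * mdeg n + 2 * k)%N = d.

Definition toda_H (G : flagData R r) : D :=
  \sum_i \sum_j scalarA (ip (coroot G i) (coroot G j)) *: ('X_i * 'X_j)
  - \sum_i (scalarA (ip (coroot G i) (coroot G i)) * 'X_i)%:MP.

(* The third clause: at q = 0, P becomes p(h d_1, ..., h d_r). *)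
Definition toda_operator (G : flagData R r) (p : {mpoly C[r]}) (P : D) :=
  [/\ exists d, Dh_homog d P,
      op P \o op (toda_H G) =1 op (toda_H G) \o op P
    & forall m, (P@_m)@_0%MM = (p@_m)%:P].

Variable ops : 'I_r -> D.

(* The left ideal of D^h generated by the ops i; M^h is the quotient by it. *)
Definition in_left_ideal (F : A -> A) :=
  exists a : 'I_r -> D, F =1 fun f => \sum_i op (a i) (op (ops i) f).

Section Basis.
Variables (n : nat) (P : 'I_n -> D).

Definition Mh_basis := forall Z : D, exists! a : 'rV[A]_n,
  in_left_ideal (fun f => op Z f - \sum_k a 0 k * op (P k) f).

(* hOm i is the matrix h Omega_i, which has entries in C[q,h]:
   [h d_i P_j] = \sum_k (h Omega_i)_kj [P_k]. *)
Definition connection_matrices (hOm : 'I_r -> 'M[A]_n) := forall i j,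
  in_left_ideal (fun f =>
    op 'X_i (op (P j) f) - \sum_k hOm i k j * op (P k) f).

End Basis.

Definition term_order (le : rel 'X_{1..r}) :=
  [/\ [/\ reflexive le, antisymmetric le, transitive le & total le],
      forall m, le 0%MM m
    & forall m m1 m2, le m1 m2 -> le (m + m1)%MM (m + m2)%MM].

Definition leading (le : rel 'X_{1..r}) (Z : D) (m : 'X_{1..r}) :=
  m \in msupp Z /\ forall m', m' \in msupp Z -> le m' m.

(* The leading term of every element of the left ideal lies in the ideal of
   the commutative ring C[q,h][x_1..x_r] that is generated by the leading
   terms of the gb j. *)
Definition groebner (le : rel 'X_{1..r}) (N : nat) (gb : 'I_N -> D)
    (lm : 'I_N -> 'X_{1..r}) :=
  (forall j, in_left_ideal (op (gb j)) /\ leading le (gb j) (lm j)) /\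
  forall Z m, in_left_ideal (op Z) -> leading le Z m ->
    exists b : 'I_N -> D,
      Z@_m *: 'X_[m] = \sum_j b j * ((gb j)@_(lm j) *: 'X_[lm j]).

(* m_0, ..., m_s are the exponents of the standard monomials. *)
Definition standard_monomials (s : nat) (m : 'I_s.+1 -> 'X_{1..r}) :=
  (exists le N (gb : 'I_N -> D) lm,
    [/\ term_order le, groebner le gb lm
      & forall m', (exists k, m k = m') <-> (forall j, ~~ (lm j <= m')%MM)]) /\
  [/\ injective m, m ord0 = 0%MM
    & forall i j : 'I_s.+1, (i <= j)%N -> (mdeg (m i) <= mdeg (m j))%N].

End Toda.

Section Loops.
Variable R : realType.
Local Notation C := (Cx R).

Definition circle (x : R) : C := (cos x +i* sin x)%C.

Definition reC (f : R -> C) (x : R) : R := complex.Re (f x).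
Definition imC (f : R -> C) (x : R) : R := complex.Im (f x).

Definition smooth (f : R -> C) := forall (j : nat) (x : R),
  derivable (derive1n j (reC f)) x 1 /\ derivable (derive1n j (imC f)) x 1.

Definition derivC (j : nat) (f : R -> C) (x : R) : C :=
  (derive1n j (reC f) x +i* derive1n j (imC f) x)%C.

Definition abs_sums_to (u : nat -> C) (l : C) :=
  cvgn [normed series u] /\ series u @ \oo --> l.

Section LoopGroup.
Variable n : nat.
Implicit Type c : C -> 'M[C]_n.

(* A loop is a function on C of which only the values on the circle matter;
   elements of the two factors of the Birkhoff factorization also have values
   outside, respectively inside, the unit disc. *)
Definition smooth_loop c :=
  (forall x, c (circle x) \in unitmx) /\
  (forall a b, smooth (fun x => c (circle x) a b)).

Definition minus_loop c := smooth_loop c /\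
  exists B : nat -> 'M[C]_n, B 0%N = 1%:M /\
    forall h, 1 <= `|h| -> c h \in unitmx /\
      forall a b, abs_sums_to (fun k => B k a b * h ^- k) (c h a b).

Definition plus_loop c := smooth_loop c /\
  exists B : nat -> 'M[C]_n,
    forall h, `|h| <= 1 -> c h \in unitmx /\
      forall a b, abs_sums_to (fun k => B k a b * h ^+ k) (c h a b).

End LoopGroup.

Variables r n : nat.
Local Notation A := (coefRing R r).

Definition evqh (q : 'rV[C]_r) (h : C) (a : A) : C :=
  (map_mpoly (horner_eval h) a).@[fun i => q 0 i].

Definition Omega (hOm : 'I_r -> 'M[A]_n) (i : 'I_r) (q : 'rV[C]_r) (h : C) :
    'M[C]_n :=
  h^-1 *: map_mx (evqh q h) (hOm i).

(* dL = L Omega at q, where Omega = \sum_i Omega_i dt_i and dt_i = dq_i / q_i,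
   as the total complex derivative of a map from an open subset of C^r to the
   smooth loops with the C^oo topology: the remainder is o(v), uniformly on the
   circle together with each of its derivatives along the circle. *)
Definition dL_eq_LOmega (hOm : 'I_r -> 'M[A]_n)
    (L : 'rV[C]_r -> C -> 'M[C]_n) (q : 'rV[C]_r) :=
  forall (j : nat) (e : R), 0 < e ->
    \forall v \near (0 : 'rV[C]_r), forall (x : R) (a b : 'I_n),
      `|derivC j (fun y => (L (q + v) (circle y) - L q (circle y)
           - \sum_i (v 0 i / q 0 i) *:
               (L q (circle y) *m Omega hOm i q (circle y))) a b) x|
      <= e%:C%C * `|v|.

(* Q0 is obtained from Omega by the construction with Birkhoff factorization
   L = L_- L_+ over a nonempty open set U on which all the q_i are nonzero, so
   that t_i = log q_i are local coordinates. *)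
Definition is_Q0 (hOm : 'I_r -> 'M[A]_n) (Q0 : 'rV[C]_r -> 'M[C]_n) :=
  exists (U : set 'rV[C]_r) (L Lm : 'rV[C]_r -> C -> 'M[C]_n) (Lp : 'M[A]_n),
  [/\ open U, U !=set0 & forall q i, U q -> q 0 i != 0] /\
  [/\ forall q, U q -> smooth_loop (L q) /\ dL_eq_LOmega hOm L q,
      forall q, U q -> minus_loop (Lm q) /\
        plus_loop (fun h => map_mx (evqh q h) Lp),
      forall q x, U q ->
        L q (circle x) = Lm q (circle x) *m map_mx (evqh q (circle x)) Lp,
      map_mx (mcoeff 0%MM) Lp = 1%:M
    & forall q, Q0 q = map_mx (evqh q 0) Lp].

End Loops.

(* Main.v *)
Require Import Defs.
From HB Require Import structures.
From mathcomp Require Import all_boot all_order all_algebra.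
From mathcomp Require Import complex mpoly ssrcomplements zify ring.
From mathcomp Require Import all_classical all_reals all_analysis.
Set Implicit Arguments.
Unset Strict Implicit.
Unset Printing Implicit Defensive.
Import Order.TTheory GRing.Theory Num.Theory.
Local Open Scope ring_scope.

(** A constant change of basis conjugates the connection matrices, so that
    [h Omega'_i = C^-1 (h Omega_i) C] (lemma [connection_change_basis]).  Hence
    [C L'_+ C^-1] solves the same problem as [L_+], and it is enough that
    this problem has a single solution, whose determinant is moreover 1, which
    makes its value at [h = 0] invertible for every [q].

    To see this, write [X] for [L_+], [A_i] for [h Omega_i] and [d_i] for
    [h q_i d/dq_i], which is [hd i] below.  Differentiating [L = L_- X] and
    using [dL = L Omega] gives, for [|h| = 1],
      [h q_i dL_-/dq_i = L_- w_i]   with   [w_i = (X A_i - d_i X) X^-1].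
    The left side is a uniform limit, on the circle, of difference quotients
    that extend to series in [1/h] without positive powers of [h]; on the right,
    [L_-] is invertible for [|h| >= 1] and [w_i] extends to [|h| <= 1].  By an
    argument of Liouville type (lemma [liouville]) [w_i] does not depend on [h].
    Clearing the denominator [det X], this becomes an identity between elements
    of C[q,h], valid for [q] in an open set, hence always.

    Its trace, together with the formula for the derivative of a determinant,
    shows that each [d_i] multiplies [det X] by a polynomial.  As [d_i] does not
    increase the degree in [q] and kills the constant term, this polynomial is 0,
    and [det X = 1] because this is so at [q = 0].  Therefore
      [d_i X = X A_i - W_i X]
    with polynomial matrices [W_i] that do not involve [h] (lemma
    [birkhoff_gauge]).

    Such an [X] with [X = 1] at [q = 0] is unique (lemma
    [h_free_gauge_unique]).  If two solutions [X], [Y] agree in degrees in [q]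
    below that of [q^m], the coefficient [D] of [q^m] in [X - Y] satisfies
    [m_i h D = D a - a D - e] with [a], [e] free of [h].  For [m_i > 0] the
    degree in [h] of the left side is too large unless [D = 0]. *)

(** * Auxiliary facts *)

Lemma mnm_neq0_ex (r : nat) (m : 'X_{1..r}) : m != 0%MM -> exists i, (0 < m i)%N.
Proof.
move=> m0; apply/existsP; apply: contraNT m0; rewrite negb_exists => /forallP mi0.
by apply/eqP/mnmP => i; rewrite mnm0E; have := mi0 i; rewrite lt0n negbK => /eqP ->.
Qed.

Lemma mnm_subU1K (r : nat) (m : 'X_{1..r}) i :
  (0 < m i)%N -> (m - U_(i) + U_(i))%MM = m.
Proof.
move=> mi_gt0; rewrite submK //; apply/mnm_lepP => l; rewrite mnm1E.
by case: (i =P l) => // <-.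
Qed.

Lemma size_mx_bounded (K : nzSemiRingType) m n (M : 'M[{poly K}]_(m, n)) :
  exists d, forall i j, (size (M i j) <= d)%N.
Proof.
exists (\max_i \max_j size (M i j))%N => i j.
apply: (@leq_trans (\max_j size (M i j))%N).
  exact: (leq_bigmax (F := fun j => size (M i j))).
exact: (leq_bigmax (F := fun i => \max_j size (M i j))%N).
Qed.

(** * Derivative of a determinant *)

Section Jacobi.
Variables (A : comNzRingType) (d : {additive A -> A}).
Hypothesis dM : forall a b, d (a * b) = d a * b + a * d b.

Lemma derivation_prod (I : eqType) (s : seq I) (F : I -> A) : uniq s ->
  d (\prod_(j <- s) F j) =
  \sum_(i <- s) \prod_(j <- s) (if j == i then d (F j) else F j).
Proof.
have d1 : d 1 = 0.
  by apply: (addrI (d 1)); rewrite addr0 -{3}[1]mulr1 dM mul1r mulr1.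
elim: s => [|k s IHs] /=; first by rewrite !big_nil d1.
case/andP=> ks us; rewrite !big_cons dM IHs // eqxx; congr (_ * _ + _).
  rewrite [RHS]big_seq [LHS]big_seq; apply: eq_bigr => j js.
  by case: eqP => // jk; rewrite -jk js in ks.
rewrite mulr_sumr [RHS]big_seq [LHS]big_seq; apply: eq_bigr => i is_.
by rewrite big_cons; case: eqP => // ki; rewrite ki is_ in ks.
Qed.

(** Jacobi's formula, valid for any derivation.  Applying the Leibniz rule to
    the expansion over permutations gives the sum of the determinants in which
    one row is differentiated; each is then expanded along that row. *)
Lemma derivation_det n (M : 'M[A]_n) :
  d (\det M) = \tr (map_mx d M *m \adj M).
Proof.
pose Mi i := \matrix_(k, l) (if k == i then d (M k l) else M k l).
have detMi i : \det (Mi i) = \sum_l d (M i l) * cofactor M i l.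
  rewrite (expand_det_row _ i); apply: eq_bigr => l _; rewrite mxE eqxx.
  congr (_ * (_ * \det _)); apply/matrixP=> a b; rewrite !mxE.
  by rewrite eq_sym (negbTE (neq_lift _ _)).
transitivity (\sum_i \det (Mi i)).
  rewrite raddf_sum /= exchange_big /=; apply: eq_bigr => s _.
  have -> (b : bool) (u : A) : d ((-1) ^+ b * u) = (-1) ^+ b * d u.
    by rewrite !mulr_sign; case: b; rewrite // raddfN.
  rewrite derivation_prod ?index_enum_uniq // -mulr_sumr; congr (_ * _).
  by apply: eq_bigr => i _; apply: eq_bigr => j _; rewrite mxE.
apply: eq_bigr => i _; rewrite detMi mxE; apply: eq_bigr => l _.
by rewrite !mxE.
Qed.

End Jacobi.

(** * Uniqueness of the gauge transformation *)

Section Algebra.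
Variables (R : realType) (r : nat).
Local Notation C := (Cx R).
Local Notation A := (coefRing R r).

(** The operators [hd i] are simultaneously diagonal on monomials in [q]; this
    is what makes comparison of coefficients effective below. *)
Lemma hd_coef i (f : A) m : (hd i f)@_m = ((m i)%:R * 'X) * f@_m.
Proof.
rewrite /hd mcoeffZ mulrAC mulrC; congr (_ * _).
case: (posnP (m i)) => [mi0|mi_gt0].
  rewrite mi0 mul0r mcoeffM big1 // => -[k1 k2] /= /eqP mE.
  rewrite mcoeffX; case: eqP => [k1E|_]; last by rewrite mul0r.
  have := congr1 (fun n : 'X_{1..r} => n i) mE.
  by rewrite /= mnmDE -k1E mnm1E eqxx mi0.
have mE := mnm_subU1K mi_gt0.
rewrite [X in X = _](_ : _ = (f^`M(i) * 'X_i)@_(U_(i) + (m - U_(i)))); last first.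
  by rewrite mulrC addmC mE.
rewrite mcoeffMX mcoeff_mderiv mE mulr_natl.
by rewrite mnmBE mnm1E eqxx subn1 prednK.
Qed.

Lemma hd_is_additive (i : 'I_r) : additive (@hd R r i).
Proof. by move=> f g; rewrite /hd mderivB mulrBr scalerBr. Qed.

HB.instance Definition _ (i : 'I_r) :=
  GRing.isZmodMorphism.Build A A (@hd R r i) (hd_is_additive i).

Lemma hdM (i : 'I_r) (f g : A) : hd i (f * g) = hd i f * g + f * hd i g.
Proof.
by rewrite /hd mderivM -!mul_mpolyC; ring.
Qed.

Lemma hdZ (i : 'I_r) (c : {poly C}) (f : A) : hd i (c *: f) = c *: hd i f.
Proof. by rewrite /hd mderivZ -!mul_mpolyC; ring. Qed.

(** By the formula [hd_coef], [hd i f] has no larger degree in [q] than [f] and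
    no constant term.  The first fact forces [g i] to be constant in [q], and the
    second one then forces it to vanish. *)
Lemma hd_eigen_eq1 (f : A) (g : 'I_r -> A) :
  (forall i, hd i f = f * g i) -> f@_0%MM = 1 -> f = 1.
Proof.
move=> hdf f0.
have f_neq0 : f != 0.
  by apply: contraTneq (oner_neq0 {poly C}) => fE; rewrite -f0 fE mcoeff0 eqxx.
have g0 i : g i = 0.
  apply/eqP; apply: contraTT isT => gi_neq0.
  have le1 : (msize (g i) <= 1)%N.
    have : (msize (f * g i) <= msize f)%N.
      rewrite -hdf msizeE; apply/bigmax_leqP_seq => m.
      rewrite mcoeff_msupp hd_coef mulf_eq0 negb_or -mcoeff_msupp.
      by case/andP=> _ /msize_mdeg_lt.
    rewrite msizeM //; case: (msize f) (msize_poly_eq0 f) => [|k _].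
      by rewrite eqxx (negbTE f_neq0).
    by rewrite addSn /= -[X in (_ <= X)%N]addn1 leq_add2l.
  move: gi_neq0; rewrite (msize1_polyC le1).
  have := congr1 (mcoeff 0%MM) (hdf i); rewrite hd_coef mnm0E mul0r mul0r.
  by rewrite rmorphM /= f0 mul1r => <-; rewrite eqxx.
apply/mpolyP => m; rewrite mcoeff1; case: eqP => [->//|/eqP m_neq0].
have [i mi_gt0] := mnm_neq0_ex m_neq0.
have := congr1 (mcoeff m) (hdf i); rewrite hd_coef g0 mulr0 mcoeff0 => /eqP.
by rewrite -polyC_natr !mulf_eq0 polyX_eq0 polyC_eq0 pnatr_eq0
  (gtn_eqF mi_gt0) /= => /eqP.
Qed.

Definition h_free (f : A) := forall m, (size f@_m <= 1)%N.

Lemma mcoeffM_low (f g : A) m :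
    (forall k, (mdeg k < mdeg m)%N -> f@_k = 0) ->
  (f * g)@_m = f@_m * g@_0%MM.
Proof.
move=> f_low; rewrite mcoeffM.
have ltm : (mdeg m < (mdeg m).+1)%N by [].
have lt0 : (mdeg (0%MM : 'X_{1..r}) < (mdeg m).+1)%N by rewrite mdeg0.
rewrite (bigD1 (BMultinom ltm, BMultinom lt0)) /= ?addm0 ?eqxx //.
rewrite big1 ?addr0 // => -[k1 k2] /= /andP[/eqP mE neq].
have [lt|ge] := ltnP (mdeg k1) (mdeg m); first by rewrite f_low ?mul0r.
case/negP: neq.
have k20 : (k2 : 'X_{1..r}) = 0%MM.
  by apply/eqP; rewrite -mdeg_eq0 -leqn0 -(leq_add2l (mdeg k1)) addn0 -mdegD -mE.
have k1m : (k1 : 'X_{1..r}) = m by rewrite {2}mE k20 addm0.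
by rewrite xpair_eqE -!val_eqE /=; apply/andP; split; apply/eqP;
  rewrite ?k1m ?k20.
Qed.

(** The right side has at most the degree of [D] in [h], or 0, while the left
    side has one more.  In terms of coefficients: if the coefficient of
    [h^(k+1)] in [D] vanishes, so does that of [h^k]. *)
Lemma hmul_commutator_eq0 n (D a b : 'M[{poly C}]_n) (e : nat) (E : 'M[{poly C}]_n) :
    (0 < e)%N ->
    (forall i j, size (a i j) <= 1)%N -> (forall i j, size (b i j) <= 1)%N ->
    (forall i j, size (E i j) <= 1)%N ->
  (e%:R * 'X) *: D = D *m a - b *m D - E -> D = 0.
Proof.
move=> e_gt0 a1 b1 E1 eqD.
have coef_const (p : {poly C}) k (u : {poly C}) : (size p <= 1)%N ->
    (u * p)`_k = u`_k * p`_0.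
  by move=> /size1_polyC pE; rewrite {1}pE coefMC.
have step k : (forall i j, (D i j)`_k.+1 = 0) -> forall i j, (D i j)`_k = 0.
  move=> Dk i j; have := congr1 (fun M : 'M[{poly C}]_n => (M i j)`_k.+1) eqD.
  rewrite !mxE mulrAC coefMX /= -mulr_natl !coefD !coefN.
  rewrite [(E i j)`_k.+1]nth_default ?(leq_trans (E1 i j)) // oppr0 addr0.
  rewrite !coef_sum big1 => [|l _]; last by rewrite coef_const // Dk mul0r.
  rewrite big1 => [|l _]; last by rewrite mulrC coef_const // Dk mul0r.
  rewrite subr0 mulr1 -polyC_natr coefCM => /eqP.
  by rewrite mulf_eq0 pnatr_eq0 -[e]prednK // => /eqP.
have [N szN] := size_mx_bounded D.
have all0 k : forall i j, (D i j)`_(N - k) = 0.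
  elim: k => [|k IHk] i j.
    by rewrite subn0 nth_default.
  have [lt|ge] := ltnP k N; last first.
    by move: (IHk i j); rewrite subnS (eqP (ge : N - k == 0)%N).
  by apply: step => {}i {}j; rewrite subnS prednK ?subn_gt0.
apply/matrixP => i j; rewrite mxE; apply/polyP => k; rewrite coef0.
have [lt|ge] := ltnP k N; first by have := all0 (N - k)%N i j; rewrite subKn // ltnW.
by rewrite nth_default // (leq_trans _ ge).
Qed.

(** The induction is on the total degree of the monomial [q^m] and shows at the
    same time that [X - Y] and [W i - V i] have no term of that degree. *)
Lemma h_free_gauge_unique n (X Y : 'M[A]_n) (a W V : 'I_r -> 'M[A]_n) :
    (forall i, map_mx (hd i) X = X *m a i - W i *m X) ->
    (forall i, map_mx (hd i) Y = Y *m a i - V i *m Y) ->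
    (forall i k l, h_free (W i k l)) -> (forall i k l, h_free (V i k l)) ->
    map_mx (mcoeff 0%MM) X = 1%:M -> map_mx (mcoeff 0%MM) Y = 1%:M ->
  X = Y.
Proof.
move=> eqX eqY freeW freeV X0 Y0.
pose D := X - Y; pose E i := W i - V i.
have eqD i : map_mx (hd i) D = D *m a i - W i *m D - E i *m Y.
  rewrite map_mxB eqX eqY /D /E !mulmxBl !mulmxBr.
  move: (X *m a i) (W i *m X) (Y *m a i) (V i *m Y) (W i *m Y) => u1 u2 u3 u4 u5.
  by apply/matrixP => k l; rewrite !mxE; ring.
pose c m (M : 'M[A]_n) := map_mx (mcoeff m) M.
have c_low m (M N : 'M[A]_n) : (forall k, (mdeg k < mdeg m)%N -> c k M = 0) ->
    c m (M *m N) = c m M *m c 0%MM N.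
  move=> M_low; apply/matrixP => k l; rewrite !mxE raddf_sum.
  apply: eq_bigr => j _ /=; rewrite mcoeffM_low ?mxE // => m' lt.
  by have := congr1 (fun M : 'M[{poly C}]_n => M k j) (M_low _ lt); rewrite !mxE.
have c_low' m (M N : 'M[A]_n) : (forall k, (mdeg k < mdeg m)%N -> c k M = 0) ->
    c m (N *m M) = c 0%MM N *m c m M.
  move=> M_low; apply/matrixP => k l; rewrite !mxE raddf_sum.
  apply: eq_bigr => j _ /=; rewrite mulrC mcoeffM_low ?mxE 1?mulrC // => m' lt.
  by have := congr1 (fun M : 'M[{poly C}]_n => M j l) (M_low _ lt); rewrite !mxE.
have c_hd i m (M : 'M[A]_n) : c m (map_mx (hd i) M) = ((m i)%:R * 'X) *: c m M.
  by apply/matrixP => k l; rewrite !mxE hd_coef.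
(* At q = 0 the equation for X reads 0 = a - W, so that a is free of h there. *)
have a0 i : c 0%MM (a i) = c 0%MM (W i).
  have low (M : 'M[A]_n) k :
    (mdeg k < mdeg (0%MM : 'X_{1..r}))%N -> c k M = 0 by rewrite mdeg0.
  have := congr1 (c 0%MM) (eqX i); rewrite c_hd mnm0E mul0r scale0r.
  rewrite {1}/c map_mxB -!/(c _ _) !c_low; [|exact: low..].
  by rewrite [c _ X]X0 mul1mx mulmx1 => /esym/eqP; rewrite subr_eq0 => /eqP.
have const_c m (M : 'M[A]_n) : (forall k l, h_free (M k l)) ->
    forall k l, (size (c m M k l) <= 1)%N.
  by move=> freeM k l; rewrite mxE; apply: freeM.
have DE0 k m : (mdeg m < k)%N -> c m D = 0 /\ forall i, c m (E i) = 0.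
  elim: k m => // k IHk m; rewrite ltnS => le_mk.
  have D_low m' : (mdeg m' < mdeg m)%N -> c m' D = 0.
    by move=> lt; case: (IHk m') => //; apply: leq_trans le_mk.
  have E_low i m' : (mdeg m' < mdeg m)%N -> c m' (E i) = 0.
    by move=> lt; case: (IHk m') => //; apply: leq_trans le_mk.
  have cD i : ((m i)%:R * 'X) *: c m D =
      c m D *m c 0%MM (W i) - c 0%MM (W i) *m c m D - c m (E i).
    rewrite -c_hd eqD {1}/c !map_mxB -!/(c _ _) -a0 (c_low m D) //.
    by rewrite (c_low m (E i) Y (E_low i)) (c_low' m D) // [c _ Y]Y0 mulmx1 a0.
  have D0 : c m D = 0.
    have [m0|m_neq0] := eqVneq m 0%MM.
      by rewrite m0 /c map_mxB X0 Y0 subrr.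
    have [i mi_gt0] := mnm_neq0_ex m_neq0.
    apply: hmul_commutator_eq0 mi_gt0 _ _ _ (cD i); try exact: const_c.
    move=> k' l; rewrite /c /E map_mxB !mxE (leq_trans (size_polyD _ _)) //.
    by rewrite size_polyN geq_max freeW freeV.
  split=> // i; have := cD i.
  by rewrite D0 scaler0 mul0mx mulmx0 subrr sub0r => /esym/eqP; rewrite oppr_eq0 => /eqP.
apply/eqP; rewrite -subr_eq0; apply/eqP/matrixP => k l; rewrite [RHS]mxE.
apply/mpolyP => m; have [D0 _] := DE0 (mdeg m).+1 m (leqnn _).
by have := congr1 (fun M : 'M[{poly C}]_n => M k l) D0; rewrite !mxE mcoeff0.
Qed.

End Algebra.

(** * Uniform limits of polynomials in 1/h *)

Section Outer.
Variable K : numClosedFieldType.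
Implicit Types (f g k : K -> K) (p u : {poly K}) (e M z h : K).

(** Cauchy's estimate without integration.  The even and odd parts of [p] are
    [(p(z) + p(-z)) / 2] and [(p(z) - p(-z)) / 2], so the polynomials [u], [v] with
    [p(z) = u(z^2) + z v(z^2)] satisfy the same bound on the circle, and they have
    about half the degree of [p]. *)
Lemma coef_le_circle_bound p M :
    (forall z, `|z| = 1 -> `|p.[z]| <= M) -> forall i, `|p`_i| <= M.
Proof.
have [N] := ubnP (size p); elim: N p => // N IHN p; rewrite ltnS => szN bound i.
have M_ge0 : 0 <= M by apply: le_trans (bound 1 (normr1 _)).
have [sz1|sz_gt1] := leqP (size p) 1.
  case: i => [|i]; last by rewrite nth_default ?normr0 // (leq_trans sz1).
  by have := bound 1 (normr1 _); rewrite (size1_polyC sz1) hornerC coefC.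
have parity z : p.[z] = (even_poly p).[z ^+ 2] + (odd_poly p).[z ^+ 2] * z.
  by rewrite -{1}[p]poly_even_odd !hornerE !horner_comp !hornerE.
have root (w : K) : `|w| = 1 -> exists2 z, `|z| = 1 & z ^+ 2 = w.
  move=> w1; exists (sqrtC w); last exact: sqrtCK.
  by rewrite norm_rootC w1 sqrtC1.
have half_bound (x y : K) : `|x| <= M -> `|y| <= M -> `|(x + y) / 2%:R| <= M.
  move=> xM yM; rewrite normrM [X in _ * X]ger0_norm ?invr_ge0 ?ler0n //.
  rewrite ler_pdivrMr ?ltr0n // mulr_natr mulr2n.
  by apply: le_trans (ler_normD _ _) _; apply: lerD.
have two_neq0 : 2%:R != 0 :> K by rewrite pnatr_eq0.
have boundE (w : K) : `|w| = 1 -> `|(even_poly p).[w]| <= M.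
  move=> /root[z z1 <-].
  have -> : (even_poly p).[z ^+ 2] = (p.[z] + p.[- z]) / 2%:R.
    rewrite !parity sqrrN; move: (_.[_]) (_.[_]) => x y.
    by field.
  by apply: half_bound; apply: bound; rewrite ?normrN.
have boundO (w : K) : `|w| = 1 -> `|(odd_poly p).[w]| <= M.
  move=> /root[z z1 <-].
  have -> : `|(odd_poly p).[z ^+ 2]| = `|(p.[z] + - p.[- z]) / 2%:R|.
    transitivity `|(odd_poly p).[z ^+ 2] * z|; first by rewrite normrM z1 mulr1.
    congr `|_|.
    rewrite !parity sqrrN; move: (_.[_]) (_.[_]) => x y.
    by field.
  by apply: half_bound; rewrite ?normrN; apply: bound; rewrite ?normrN.
have szE : (size (even_poly p) < N)%N.
  apply: leq_trans szN; apply: leq_ltn_trans (size_even_poly _) _.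
  rewrite ltn_uphalf_double; case: (size p) sz_gt1 => [|[|[|]]] // n _.
  by rewrite -addnn; lia.
have szO : (size (odd_poly p) < N)%N.
  apply: leq_trans szN; apply: leq_ltn_trans (size_odd_poly _) _.
  by rewrite ltn_half_double -addnn; lia.
rewrite -(odd_double_half i); case: (odd i).
  by rewrite add1n -coef_odd_poly; apply: IHN.
by rewrite add0n -coef_even_poly; apply: IHN.
Qed.

Lemma horner_disc_bound p M z :
    (forall z, `|z| = 1 -> `|p.[z]| <= M) -> `|z| < 1 ->
  (1 - `|z|) * `|p.[z]| <= M.
Proof.
move=> bound z_lt1.
have M_ge0 : 0 <= M by apply: le_trans (bound 1 (normr1 _)).
have z1 : 0 <= 1 - `|z| by rewrite subr_ge0 ltW.
apply: (@le_trans _ _ ((1 - `|z|) * \sum_(i < size p) M * `|z| ^+ i)).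
  apply: ler_wpM2l => //; rewrite horner_coef.
  apply: le_trans (ler_norm_sum _ _ _) _; apply: ler_sum => i _.
  rewrite normrM normrX ler_wpM2r ?exprn_ge0 //.
  exact: coef_le_circle_bound.
rewrite -mulr_sumr mulrCA -[1 - _]opprB mulNr -subrX1 opprB.
by rewrite ler_piMr // lerBlDr lerDl exprn_ge0.
Qed.

Lemma horner_disc_bounded p : exists2 B, 0 <= B & forall z, `|z| <= 1 -> `|p.[z]| <= B.
Proof.
exists (\sum_(i < size p) `|p`_i|); first exact: sumr_ge0.
move=> z z1; rewrite horner_coef; apply: le_trans (ler_norm_sum _ _ _) _.
apply: ler_sum => i _; rewrite normrM normrX ler_piMr //.
by rewrite exprn_ile1.
Qed.

(** Uniform limits, on the closed exterior of the unit disc, of polynomials in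
    [1/h]: they are continuous there, and analytic in the interior including
    infinity.  Entries of the factor [L_-] are of this kind. *)
Definition outer f := forall e, 0 < e ->
  exists p, forall h, 1 <= `|h| -> `|f h - p.[h^-1]| <= e.

Lemma inv_in_disc h : 1 <= `|h| -> `|h^-1| <= 1.
Proof. by move=> h1; rewrite normfV invf_le1 // (lt_le_trans ltr01). Qed.

Lemma eq_outer f g : (forall h, 1 <= `|h| -> f h = g h) -> outer f -> outer g.
Proof.
by move=> fg of_ e /of_[p fp]; exists p => h h1; rewrite -fg //; apply: fp.
Qed.

Lemma outer_poly p : outer (fun h => p.[h^-1]).
Proof. by move=> e e0; exists p => h _; rewrite subrr normr0 ltW. Qed.

Lemma outerC c : outer (fun=> c).
Proof. by apply: eq_outer (outer_poly c%:P) => h _; rewrite hornerC. Qed.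

Lemma outerD f g : outer f -> outer g -> outer (fun h => f h + g h).
Proof.
move=> of_ og e e0; have e2 : 0 < e / 2%:R by rewrite divr_gt0 ?ltr0n.
have [p fp] := of_ _ e2; have [u gu] := og _ e2.
exists (p + u) => h h1; rewrite hornerD opprD addrACA [e]splitr.
by apply: le_trans (ler_normD _ _) _; apply: lerD; [apply: fp | apply: gu].
Qed.

Lemma outer_bounded f : outer f ->
  exists2 B, 0 <= B & forall h, 1 <= `|h| -> `|f h| <= B.
Proof.
move=> /(_ 1 ltr01)[p fp]; have [B B0 pB] := horner_disc_bounded p.
exists (B + 1); rewrite ?addr_ge0 // => h h1.
rewrite -[f h](subrK p.[h^-1]) addrC; apply: le_trans (ler_normD _ _) _.
by apply: lerD; [apply/pB/inv_in_disc | apply: fp].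
Qed.

Lemma outerM f g : outer f -> outer g -> outer (fun h => f h * g h).
Proof.
move=> of_ og e e0.
have [Bf Bf0 fB] := outer_bounded of_.
have posB (B : K) : 0 <= B -> 0 < B + 1 by move=> B0; rewrite ltr_wpDl.
have e2 (B : K) : 0 <= B -> 0 < e / 2%:R / (B + 1).
  by move=> B0; rewrite !divr_gt0 ?ltr0n // posB.
have [u gu] := og _ (e2 _ Bf0); have [Bu Bu0 uB] := horner_disc_bounded u.
have [p fp] := of_ _ (e2 _ Bu0).
exists (p * u) => h h1; rewrite hornerM.
have -> : f h * g h - p.[h^-1] * u.[h^-1] =
  f h * (g h - u.[h^-1]) + (f h - p.[h^-1]) * u.[h^-1] by ring.
have le2 (a b B : K) : 0 <= B -> `|a| <= B -> `|b| <= e / 2%:R / (B + 1) ->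
    `|a * b| <= e / 2%:R.
  move=> B0 aB be; rewrite normrM.
  apply: (@le_trans _ _ ((B + 1) * (e / 2%:R / (B + 1)))).
    by apply: ler_pM => //; apply: le_trans aB _; rewrite lerDl.
  by rewrite mulrCA divff ?mulr1 // gt_eqF ?posB.
rewrite [e]splitr; apply: le_trans (ler_normD _ _) _; apply: lerD.
  by apply: le2 Bf0 _ _; [apply: fB | apply: gu].
by rewrite mulrC; apply: le2 Bu0 _ _; [apply/uB/inv_in_disc | apply: fp].
Qed.

Lemma outer_sum I (s : seq I) (F : I -> K -> K) :
  (forall i, outer (F i)) -> outer (fun h => \sum_(i <- s) F i h).
Proof.
move=> oF; elim: s => [|i s IHs].
  by apply: eq_outer (outerC 0) => h _; rewrite big_nil.
by apply: eq_outer (outerD (oF i) IHs) => h _; rewrite big_cons.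
Qed.

Lemma outerV : outer (fun h => h^-1).
Proof. by apply: eq_outer (outer_poly 'X) => h _; rewrite hornerX. Qed.

Lemma outerVX n : outer (fun h => h^-1 ^+ n).
Proof. by apply: eq_outer (outer_poly 'X^n) => h _; rewrite hornerXn. Qed.

Lemma outer_scaled_poly n u : (size u <= n.+1)%N ->
  outer (fun h => h^-1 ^+ n * u.[h]).
Proof.
move=> szu.
have := @outer_sum _ (index_enum 'I_n.+1)
  (fun i h => u`_i * h^-1 ^+ (n - i)) (fun i => outerM (outerC _) (outerVX _)).
apply: eq_outer => h h1; rewrite (horner_coef_wide _ szu) mulr_sumr.
have h0 : h != 0 by rewrite -normr_gt0 (lt_le_trans ltr01).
apply: eq_bigr => i _; rewrite mulrCA; congr (_ * _).
have ltin : (i <= n)%N by rewrite -ltnS.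
have -> : h^-1 ^+ n = h^-1 ^+ (n - i) * h^-1 ^+ i by rewrite -exprD subnK.
by rewrite -mulrA -exprMn mulVf // expr1n mulr1.
Qed.

(** A weak form of the maximum principle: the values of an outer function are
    controlled by its values on the circle.  The factor comes from summing the
    geometric series in Cauchy's estimate. *)
Lemma outer_max f M a : outer f -> (forall z, `|z| = 1 -> `|f z| <= M) ->
  1 < `|a| -> (1 - `|a|^-1) * `|f a| <= M.
Proof.
move=> of_ fM a1; apply/ler_addgt0Pr => e e0.
have [p fp] := of_ _ (divr_gt0 e0 (ltr0n _ 2)).
have a0 : 0 < `|a| by apply: lt_trans a1.
have pM z : `|z| = 1 -> `|p.[z]| <= M + e / 2%:R.
  move=> z1; have zV1 : `|z^-1| = 1 by rewrite normfV z1 invr1.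
  rewrite -[p.[z]](subrK (f z^-1)) addrC.
  apply: le_trans (ler_normD _ _) _; apply: lerD; first exact: fM.
  by rewrite distrC -{2}[z]invrK; apply: fp; rewrite zV1.
have aV1 : `|a^-1| < 1 by rewrite normfV invf_lt1.
have := horner_disc_bound pM aV1; rewrite normfV => bound.
have f_le : `|f a| <= `|p.[a^-1]| + `|f a - p.[a^-1]|.
  by rewrite -{1}[f a](subrK p.[a^-1]) addrC ler_normD.
apply: (@le_trans _ _ ((1 - `|a|^-1) * (`|p.[a^-1]| + `|f a - p.[a^-1]|))).
  by apply: ler_wpM2l => //; rewrite subr_ge0 invf_le1 // ltW.
rewrite mulrDr [X in _ <= _ + X]splitr addrA; apply: lerD => //.
by apply: le_trans _ (fp _ (ltW a1)); rewrite ler_piMl // lerBlDr lerDl invr_ge0.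
Qed.

(** The maximum principle at infinity, where the value of [f] is [l]. *)
Lemma outer_limit_le f k l M : outer k ->
    (forall h, 1 <= `|h| -> f h = l + h^-1 * k h) ->
    (forall z, `|z| = 1 -> `|f z| <= M) ->
  `|l| <= M.
Proof.
move=> ok fE fM; apply/ler_addgt0Pr => e e0; have [p kp] := ok _ e0.
have := @coef_le_circle_bound (l%:P + 'X * p) (M + e) _ 0.
rewrite coefD coefC coefXM addr0; apply=> z z1.
have zV1 : `|z^-1| = 1 by rewrite normfV z1 invr1.
rewrite !hornerE.
have -> : l + z * p.[z] = f z^-1 - z * (k z^-1 - p.[z]).
  by rewrite fE ?zV1 // invrK; ring.
apply: le_trans (ler_normB _ _) _; apply: lerD; first exact: fM.
by rewrite normrM z1 mul1r -{2}[z]invrK kp ?zV1.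
Qed.

Lemma root_outside_disc p :
    (forall z, `|z| <= 1 -> p.[z] != 0) -> size p != 1%N ->
  exists x p1, [/\ 1 < `|x|, p = p1 * ('X - x%:P), (size p1 < size p)%N
    & forall z, `|z| <= 1 -> p1.[z] != 0].
Proof.
move=> p_neq0 sz1; have [x px] := closed_rootP _ sz1.
have p0 : p != 0 by apply: contra_neq (p_neq0 0 _) => [->|]; rewrite ?horner0 ?normr0.
have pE : p = (p %/ ('X - x%:P)) * ('X - x%:P) by rewrite divpK // dvdp_XsubCl.
exists x, (p %/ ('X - x%:P)); split=> // [||z z1].
- rewrite real_ltNge ?ger0_real //; apply/negP => /p_neq0.
  by rewrite (rootP px) eqxx.
- rewrite size_divp ?polyXsubC_eq0 // size_XsubC subn1.
  by rewrite prednK // size_poly_gt0.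
- by apply: contra_neq (p_neq0 _ z1) => pz; rewrite pE hornerM pz mul0r.
Qed.

End Outer.

(** * A Liouville theorem *)

Section Liouville.
Variables (K : numClosedFieldType) (n m : nat) (Lam Gam : K -> 'M[K]_n).
Hypothesis Lam_unit : forall h, 1 <= `|h| -> Lam h \in unitmx.
Hypothesis LamE : forall h, 1 <= `|h| -> Lam h = 1%:M + h^-1 *: Gam h.
Hypothesis outer_Gam : forall a b, outer (fun h => Gam h a b).

Let outer_Lam a b : outer (fun h => Lam h a b).
Proof.
apply: eq_outer (outerD (outerC (1%:M a b)) (outerM (@outerV K) (outer_Gam a b))).
by move=> h h1; rewrite LamE // !mxE.
Qed.

(** The [Psi] are meant to be difference quotients of [Lam].  Their limit is
    [Lam * N / p]; keeping [p] as a factor leaves only polynomials to deal with. *)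
Definition circle_limit (p : {poly K}) (N : 'M[{poly K}]_(n, m)) :=
  forall e : K, 0 < e -> exists Psi : K -> 'M[K]_(n, m),
    (forall a b, outer (fun h => Psi h a b)) /\
    forall z a b, `|z| = 1 -> `|p.[z] * Psi z a b
      - \sum_j Lam z a j * (N j b).[z]| <= e.

Let le_pos_eq0 (x c : K) : 0 < c -> (forall e, 0 < e -> c * `|x| <= e) -> x = 0.
Proof.
move=> c0 xe; apply/eqP; rewrite -normr_le0 -(ler_pM2l c0) mulr0.
by apply/ler_addgt0Pr => e e0; rewrite add0r xe.
Qed.

Let norm_h_neq0 (h : K) : 1 <= `|h| -> h != 0.
Proof. by move=> h1; rewrite -normr_gt0 (lt_le_trans ltr01). Qed.

(** Outer functions are bounded at infinity, so [Lam * N] has no pole there;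
    since [Lam] tends to 1, neither has [N].  The leading coefficient of [N] is
    the value at infinity of [h^-(d+1) (c Psi - Lam N)], up to sign. *)
Lemma circle_limit_const (c : K) (N : 'M[{poly K}]_(n, m)) :
  circle_limit c%:P N -> forall i j, (size (N i j) <= 1)%N.
Proof.
move=> lim.
suff sz1 d : (forall i j, (size (N i j) <= d.+1)%N) ->
    forall i j, (size (N i j) <= 1)%N.
  have [d szN] := size_mx_bounded N.
  by apply: (sz1 d) => i j; apply/leqW/szN.
elim: d => // d IHd szN; apply: IHd => a b.
apply/leq_sizeP => i; rewrite leq_eqVlt => /orP[/eqP <-|]; last first.
  by move=> lt; rewrite nth_default // (leq_trans (szN a b)).
apply: (@le_pos_eq0 _ 1) => // e e0; rewrite mul1r.
have [Psi [oPsi le_e]] := lim _ e0.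
pose w j h := h^-1 ^+ d * (take_poly d.+1 (N j b)).[h].
pose k h := h^-1 ^+ d * (c * Psi h a b)
  + - (\sum_j Gam h a j * (h^-1 ^+ d.+1 * (N j b).[h]) + w a h).
pose f h := h^-1 ^+ d.+1 * (c * Psi h a b - \sum_j Lam h a j * (N j b).[h]).
rewrite -normrN; apply: (@outer_limit_le _ f k).
- apply: outerD; first exact: outerM (outerVX _) (outerM (outerC _) (oPsi a b)).
  apply: (@eq_outer _ (fun h => -1 * (\sum_j Gam h a j *
    (h^-1 ^+ d.+1 * (N j b).[h]) + w a h))) => [h _|]; first by rewrite mulN1r.
  apply: outerM (outerC _) _; apply: outerD.
    by apply: outer_sum => j; apply: outerM => //; apply: outer_scaled_poly.
  by apply: outer_scaled_poly; apply: size_take_poly.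
- move=> h h1; have h0 := norm_h_neq0 h1.
  have NE : h^-1 ^+ d.+1 * (N a b).[h] = (N a b)`_d.+1 + h^-1 * w a h.
    rewrite -{1}(poly_take_drop d.+1 (N a b)) hornerD hornerM hornerXn mulrDr addrC.
    congr (_ + _); last by rewrite /w exprS mulrA.
    rewrite (size1_polyC (_ : size (drop_poly d.+1 (N a b)) <= 1)%N); last first.
      by rewrite size_drop_poly leq_subLR addn1 szN.
    by rewrite coef_drop_poly hornerC mulrCA -exprMn mulVf // expr1n mulr1.
  have sumE : h^-1 ^+ d.+1 * \sum_j Lam h a j * (N j b).[h] =
      h^-1 ^+ d.+1 * (N a b).[h]
      + h^-1 * \sum_j Gam h a j * (h^-1 ^+ d.+1 * (N j b).[h]).
    have Nab : (N a b).[h] = \sum_j (1%:M : 'M[K]_n) a j * (N j b).[h].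
      rewrite (bigD1 a) //= big1 ?addr0 => [|j ja]; first by rewrite mxE eqxx mul1r.
      by rewrite mxE eq_sym (negbTE ja) mul0r.
    rewrite {1}Nab !mulr_sumr -big_split /=; apply: eq_bigr => j _.
    by rewrite LamE // !mxE; ring.
  by rewrite /f mulrBr sumE NE /k exprS; ring.
- move=> z z1; rewrite /f normrM normrX normfV z1 invr1 expr1n mul1r.
  by have := le_e _ a b z1; rewrite hornerC.
Qed.

(** At a root [x] of [p] outside the disc the approximants vanish, and by the
    maximum principle so does their limit [Lam * N]; and [Lam] is invertible. *)
Lemma circle_limit_root (p : {poly K}) (N : 'M[{poly K}]_(n, m)) (x : K) :
  1 < `|x| -> root p x -> circle_limit p N -> forall i j, (N i j).[x] = 0.
Proof.
move=> x1 /rootP px lim.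
have x0 := norm_h_neq0 (ltW x1).
have [d' szN'] := size_mx_bounded N; pose d := maxn (size p) d'.
have szp : (size p <= d.+1)%N by rewrite leqW // leq_maxl.
have szN i j : (size (N i j) <= d.+1)%N.
  by apply: leqW; apply: leq_trans (leq_maxr _ _).
pose Nx : 'M[K]_(n, m) := map_mx (horner_eval x) N.
suff LN0 : Lam x *m Nx = 0.
  move=> i j; have : Nx = 0 by rewrite -(mulKmx (Lam_unit (ltW x1)) Nx) LN0 mulmx0.
  by move/(congr1 (fun M : 'M[K]_(n, m) => M i j)); rewrite !mxE.
apply/matrixP => a b; rewrite [RHS]mxE.
apply: (@le_pos_eq0 _ ((1 - `|x|^-1) * `|x^-1 ^+ d|)) => [|e e0].
  rewrite mulr_gt0 ?normr_gt0 ?expf_neq0 ?invr_eq0 // subr_gt0.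
  by rewrite invf_lt1 // normr_gt0.
have [Psi [oPsi le_e]] := lim _ e0.
pose f h := (h^-1 ^+ d * p.[h]) * Psi h a b
  + -1 * \sum_j Lam h a j * (h^-1 ^+ d * (N j b).[h]).
have fE h : f h = h^-1 ^+ d * (p.[h] * Psi h a b - \sum_j Lam h a j * (N j b).[h]).
  rewrite /f mulN1r mulrBr mulrA mulr_sumr; congr (_ - _).
  by apply: eq_bigr => j _; rewrite mulrCA.
have of_ : outer f.
  apply: outerD; first exact: outerM (outer_scaled_poly szp) (oPsi a b).
  apply: outerM (outerC _) _; apply: outer_sum => j.
  by apply: outerM => //; apply: outer_scaled_poly.
have fM z : `|z| = 1 -> `|f z| <= e.
  by move=> z1; rewrite fE normrM normrX normfV z1 invr1 expr1n mul1r le_e.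
have := outer_max of_ fM x1.
rewrite fE px mul0r sub0r mulrN normrN normrM mulrA.
by congr (_ * `|_| <= _); rewrite mxE; apply: eq_bigr => j _; rewrite mxE.
Qed.

(** [N / p] has no pole in the closed disc.  A root of [p] outside it is a root of
    [N] by [circle_limit_root], and can be divided out; when no root is left,
    [circle_limit_const] applies. *)
Lemma liouville (p : {poly K}) (N : 'M[{poly K}]_(n, m)) :
    (forall z : K, `|z| <= 1 -> p.[z] != 0) -> circle_limit p N ->
  exists F : 'M[K]_(n, m), forall i j, N i j = F i j *: p.
Proof.
have [d] := ubnP (size p); elim: d p N => // d IHd p N; rewrite ltnS => szp.
move=> p_neq0 lim; have [sz1|sz1] := eqVneq (size p) 1%N.
  have pE : p = (p`_0)%:P by rewrite -size1_polyC ?sz1.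
  have c0 : p`_0 != 0.
    by have := p_neq0 0; rewrite normr0 ler01 => /(_ isT); rewrite horner_coef0.
  rewrite pE in lim; have szN := circle_limit_const lim.
  exists (\matrix_(i, j) ((N i j)`_0 / p`_0)) => i j.
  by rewrite mxE {2}pE -alg_polyC scalerA divfK // alg_polyC -size1_polyC.
have [x [p1 [x1 pE szp1 p1_neq0]]] := root_outside_disc p_neq0 sz1.
have px : root p x by rewrite /root pE !hornerE subrr mulr0.
have Nx := circle_limit_root x1 px lim.
pose q := 'X - x%:P.
pose N1 : 'M[{poly K}]_(n, m) := map_mx (fun u => u %/ q) N.
have N_dec i j : N i j = N1 i j * q.
  by rewrite mxE divpK // dvdp_XsubCl; apply/rootP.
have [||F FE] := IHd p1 N1 _ p1_neq0.
- exact: leq_trans szp1 szp.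
- move=> e e0; have x1' : 0 < `|x| - 1 by rewrite subr_gt0.
  have [Psi [oPsi le_e]] := lim _ (mulr_gt0 e0 x1'); exists Psi; split=> // z a b z1.
  have zx : `|x| - 1 <= `|z - x| by rewrite -z1 distrC lerB_dist.
  rewrite -(ler_pM2r x1'); apply: le_trans (le_e z a b z1).
  apply: le_trans (ler_wpM2l (normr_ge0 _) zx) _; rewrite -normrM.
  rewrite mulrBl mulr_suml pE hornerM hornerXsubC mulrAC.
  rewrite (eq_bigr (fun j => Lam z a j * (N j b).[z])) // => j _.
  by rewrite N_dec hornerM hornerXsubC; ring.
by exists F => i j; rewrite N_dec FE -scalerAl -pE.
Qed.

End Liouville.

(** * Uniform convergence *)

Section UniformConvergence.
Import numFieldNormedType.Exports.
Local Open Scope classical_set_scope.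
Variables (K : numFieldType) (E T : Type) (F : set_system E).
Context {FF : Filter F}.
Implicit Types (f : E -> T -> K) (g : T -> K).

(** Uniform convergence on [T] to a bounded limit; boundedness makes the notion
    stable under products. *)
Definition uconv f g := (exists2 B, 0 <= B & forall x, `|g x| <= B) /\
  forall e : K, 0 < e -> \forall t \near F, forall x, `|f t x - g x| <= e.

Lemma uconv_cst g B : (forall x, `|g x| <= B) -> uconv (fun=> g) g.
Proof.
move=> gB; split=> [|e e0]; last by near=> t => x; rewrite subrr normr0 ltW.
have [[x _]|noT] := pselect (exists x : T, True).
  by exists B => //; apply: le_trans (gB x).
by exists 0 => // x; case: noT; exists x.
Unshelve. all: by end_near.
Qed.

Lemma near_uconv f f' g g' : uconv f g ->
  (\forall t \near F, f t =1 f' t) -> g =1 g' -> uconv f' g'.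
Proof.
move=> [gB fg] ff' gg'; have <- : g = g' by apply: funext.
split=> // e e0; near=> t => x.
have <- : f t x = f' t x by move: x; near: t; exact: ff'.
by move: x; near: t; apply: fg.
Unshelve. all: by end_near.
Qed.

Lemma uconvD f f' g g' : uconv f g -> uconv f' g' ->
  uconv (fun t x => f t x + f' t x) (fun x => g x + g' x).
Proof.
move=> [[B B0 gB] fg] [[B' B'0 gB'] fg']; split.
  exists (B + B'); first exact: addr_ge0.
  by move=> x; apply: le_trans (ler_normD _ _) _; apply: lerD.
move=> e e0; have e2 : 0 < e / 2%:R by rewrite divr_gt0.
near=> t => x; rewrite opprD addrACA [e]splitr.
apply: le_trans (ler_normD _ _) _; apply: lerD.
  by move: x; near: t; apply: fg.
by move: x; near: t; apply: fg'.
Unshelve. all: by end_near.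
Qed.

Lemma uconvM f f' g g' : uconv f g -> uconv f' g' ->
  uconv (fun t x => f t x * f' t x) (fun x => g x * g' x).
Proof.
move=> [[B B0 gB] fg] [[B' B'0 gB'] fg']; split.
  exists (B * B'); first exact: mulr_ge0.
  by move=> x; rewrite normrM; apply: ler_pM.
move=> e e0.
have posB (b : K) : 0 <= b -> 0 < b + 1 by move=> b0; rewrite ltr_wpDl.
have e2 (b : K) : 0 <= b -> 0 < e / 2%:R / (b + 1).
  by move=> b0; rewrite !divr_gt0 // posB.
near=> t => x.
have -> : f t x * f' t x - g x * g' x =
  f t x * (f' t x - g' x) + (f t x - g x) * g' x by ring.
have le2 (a b c : K) : 0 <= c -> `|a| <= c + 1 -> `|b| <= e / 2%:R / (c + 1) ->
    `|a * b| <= e / 2%:R.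
  move=> c0 ac be; rewrite normrM.
  apply: (@le_trans _ _ ((c + 1) * (e / 2%:R / (c + 1)))); first exact: ler_pM.
  by rewrite mulrCA divff ?mulr1 // gt_eqF ?posB.
rewrite [e]splitr; apply: le_trans (ler_normD _ _) _; apply: lerD.
  apply: (le2 _ _ B) => //; last by move: x; near: t; apply: fg'; apply: e2.
  have -> : f t x = g x + (f t x - g x) by ring.
  apply: le_trans (ler_normD _ _) _; apply: lerD => //.
  by move: x; near: t; apply: fg.
rewrite mulrC; apply: (le2 _ _ B') => //.
  by apply: le_trans (gB' x) _; rewrite lerDl.
by move: x; near: t; apply: fg; apply: e2.
Unshelve. all: by end_near.
Qed.

Lemma uconv_sum I (s : seq I) (f : I -> E -> T -> K) (g : I -> T -> K) :
    (forall i, uconv (f i) (g i)) ->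
  uconv (fun t x => \sum_(i <- s) f i t x) (fun x => \sum_(i <- s) g i x).
Proof.
move=> fg; elim: s => [|i s IHs].
  under [X in uconv X]eq_fun do under eq_fun do rewrite big_nil.
  under [X in uconv _ X]eq_fun do rewrite big_nil.
  by apply: (@uconv_cst _ 0) => x; rewrite normr0.
under [X in uconv X]eq_fun do under eq_fun do rewrite big_cons.
under [X in uconv _ X]eq_fun do rewrite big_cons.
exact: uconvD.
Qed.

Lemma uconvV f g (c : K) : 0 < c -> (forall x, c <= `|g x|) -> uconv f g ->
  uconv (fun t x => (f t x)^-1) (fun x => (g x)^-1).
Proof.
move=> c0 cg [_ fg]; have g0 x : g x != 0.
  by rewrite -normr_gt0 (lt_le_trans c0).
have gV x : `|(g x)^-1| <= c^-1.
  by rewrite normfV lef_pV2 ?posrE ?normr_gt0.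
split; first by exists c^-1; rewrite ?invr_ge0 ?ltW.
move=> e e0; near=> t.
have le_halfE : forall x, `|f t x - g x| <= c / 2%:R.
  by near: t; apply: fg; rewrite divr_gt0.
have le_eE : forall x, `|f t x - g x| <= e * (c * (c / 2%:R)).
  by near: t; apply: fg; rewrite mulr_gt0 ?mulr_gt0 ?divr_gt0.
move=> x; have le_half := le_halfE x; have le_e := le_eE x.
have half_le : c / 2%:R <= `|f t x|.
  have : `|g x| - `|f t x| <= c / 2%:R.
    by apply: le_trans (lerB_dist _ _) _; rewrite distrC.
  rewrite lerBlDr addrC -lerBlDr; apply: le_trans.
  by rewrite lerBrDr -splitr.
have c2 : 0 < c / 2%:R by rewrite divr_gt0.
have f0 : f t x != 0 by rewrite -normr_gt0 (lt_le_trans c2).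
have -> : (f t x)^-1 - (g x)^-1 = - ((f t x - g x) / (g x * f t x)).
  by field; rewrite g0 f0.
rewrite normrN normrM normfV ler_pdivrMr ?normr_gt0 ?mulf_neq0 //.
apply: le_trans le_e _; rewrite ler_pM2l // normrM.
by apply: ler_pM => //; apply: ltW.
Unshelve. all: by end_near.
Qed.

Definition muconv m n (f : E -> T -> 'M[K]_(m, n)) (g : T -> 'M[K]_(m, n)) :=
  forall a b, uconv (fun t x => f t x a b) (fun x => g x a b).

Lemma muconvM m n p (f : E -> T -> 'M[K]_(m, n)) (g : T -> 'M[K]_(m, n))
    (f' : E -> T -> 'M[K]_(n, p)) (g' : T -> 'M[K]_(n, p)) :
  muconv f g -> muconv f' g' ->
  muconv (fun t x => f t x *m f' t x) (fun x => g x *m g' x).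
Proof.
move=> fg fg' a b.
under [X in uconv X]eq_fun do under eq_fun do rewrite mxE.
under [X in uconv _ X]eq_fun do rewrite mxE.
by apply: uconv_sum => j; apply: uconvM.
Qed.

Lemma muconvD m n (f f' : E -> T -> 'M[K]_(m, n)) (g g' : T -> 'M[K]_(m, n)) :
  muconv f g -> muconv f' g' ->
  muconv (fun t x => f t x + f' t x) (fun x => g x + g' x).
Proof.
move=> fg fg' a b.
under [X in uconv X]eq_fun do under eq_fun do rewrite mxE.
under [X in uconv _ X]eq_fun do rewrite mxE.
exact: uconvD.
Qed.

Lemma muconvZ m n (f : E -> T -> K) (g : T -> K)
    (f' : E -> T -> 'M[K]_(m, n)) (g' : T -> 'M[K]_(m, n)) :
  uconv f g -> muconv f' g' ->
  muconv (fun t x => f t x *: f' t x) (fun x => g x *: g' x).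
Proof.
move=> fg fg' a b.
under [X in uconv X]eq_fun do under eq_fun do rewrite mxE.
under [X in uconv _ X]eq_fun do rewrite mxE.
exact: uconvM.
Qed.

Lemma near_muconv m n (f f' : E -> T -> 'M[K]_(m, n)) (g g' : T -> 'M[K]_(m, n)) :
  muconv f g -> (\forall t \near F, f t =1 f' t) -> g =1 g' -> muconv f' g'.
Proof.
move=> fg ff' gg' a b; apply: (near_uconv (fg a b)) => [|x]; last by rewrite gg'.
by apply: filterS ff' => t ff' x; rewrite ff'.
Qed.

End UniformConvergence.

(** * Evaluation of elements of C[q,h] *)

Section Evaluation.
Import numFieldNormedType.Exports.
Local Open Scope classical_set_scope.
Variables (R : realType) (r : nat).
Local Notation C := (Cx R).
Local Notation A := (coefRing R r).
Implicit Types (q : 'rV[C]_r) (h : C) (a : A).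

Lemma evqh_is_additive q h : additive (@evqh R r q h).
Proof. by move=> a b; rewrite /evqh !rmorphB. Qed.

Lemma evqh_is_monoid_morphism q h : monoid_morphism (@evqh R r q h).
Proof. by split=> [|a b]; rewrite /evqh ?rmorph1 ?rmorphM. Qed.

HB.instance Definition _ q h :=
  GRing.isZmodMorphism.Build A C (@evqh R r q h) (evqh_is_additive q h).
HB.instance Definition _ q h :=
  GRing.isMonoidMorphism.Build A C (@evqh R r q h) (evqh_is_monoid_morphism q h).

Lemma evqhC q h (c : {poly C}) : evqh q h c%:MP = c.[h].
Proof. by rewrite /evqh map_mpolyC mevalC. Qed.

Lemma evqhX q h i : evqh q h 'X_i = q 0 i.
Proof. by rewrite /evqh map_mpolyX mevalXU. Qed.

Lemma evqhZ q h (c : {poly C}) a : evqh q h (c *: a) = c.[h] * evqh q h a.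
Proof. by rewrite -mul_mpolyC rmorphM /= evqhC. Qed.

Lemma evqh_hd q h i a : evqh q h (hd i a) = h * q 0 i * evqh q h a^`M(i).
Proof. by rewrite /hd evqhZ rmorphM /= hornerX evqhX mulrA. Qed.

Lemma mpoly_ring_ind (S : comNzRingType) (Q : {mpoly S[r]} -> Prop) :
    (forall c, Q c%:MP) -> (forall i, Q 'X_i) ->
    (forall u v, Q u -> Q v -> Q (u + v)) ->
    (forall u v, Q u -> Q v -> Q (u * v)) ->
  forall u, Q u.
Proof.
move=> QC QX QD QM; elim/mpolyind => [|c m p _ _ Qp]; first by rewrite -mpolyC0.
apply: (QD) => //; rewrite -mul_mpolyC; apply: (QM) => //.
rewrite mpolyXE_id; apply: (big_ind Q) => [||i _]; [by rewrite -mpolyC1 | exact: QM | ].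
by elim: (m i) => [|k IHk]; rewrite ?expr0 -?mpolyC1 // exprS; apply: (QM).
Qed.

Definition evq q a : {poly C} := a.@[fun i => (q 0 i)%:P].

Lemma horner_evq q h a : (evq q a).[h] = evqh q h a.
Proof.
elim/mpoly_ring_ind: a => [c|i|a b IHa IHb|a b IHa IHb].
- by rewrite /evq mevalC evqhC.
- by rewrite /evq mevalXU hornerC evqhX.
- by rewrite /evq mevalD hornerD -/(evq q a) -/(evq q b) IHa IHb rmorphD.
- by rewrite /evq mevalM hornerM -/(evq q a) -/(evq q b) IHa IHb rmorphM.
Qed.

Section Derivative.
Variables (T : Type) (hh : T -> C) (q : 'rV[C]_r) (i : 'I_r).
Hypothesis hh1 : forall x, `|hh x| <= 1.

Definition shift (eps : C) := q + eps *: delta_mx 0 i.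

Lemma uconv_id : uconv (T := T) (0 : C)^' (fun eps _ => eps) (fun=> 0).
Proof.
split=> [|e e0]; first by exists 0 => // _; rewrite normr0.
by near=> eps => _; rewrite subr0; near: eps; apply: dnbhs0_le.
Unshelve. all: by end_near.
Qed.

(** Both statements are stable under sums and products and hold for the
    generators of C[q,h]; the first one is needed for the product rule. *)
Lemma uconv_evqh (a : A) :
  uconv (0 : C)^' (fun eps x => evqh (shift eps) (hh x) a) (fun x => evqh q (hh x) a)
  /\ uconv (0 : C)^'
      (fun eps x => eps^-1 * (evqh (shift eps) (hh x) a - evqh q (hh x) a))
      (fun x => evqh q (hh x) a^`M(i)).
Proof.
have cst (b : A) : (exists2 B, 0 <= B & forall x, `|evqh q (hh x) b| <= B) ->
    uconv (0 : C)^' (fun _ x => evqh q (hh x) b) (fun x => evqh q (hh x) b).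
  by case=> B _ qB; apply: uconv_cst qB.
have cvg_val (b : A) : (exists2 B, 0 <= B & forall x, `|evqh q (hh x) b| <= B) ->
    uconv (0 : C)^' (fun eps x => eps^-1 * (evqh (shift eps) (hh x) b - evqh q (hh x) b))
      (fun x => evqh q (hh x) b^`M(i)) ->
    uconv (0 : C)^' (fun eps x => evqh (shift eps) (hh x) b) (fun x => evqh q (hh x) b).
  move=> bd db.
  apply: (near_uconv (uconvD (cst _ bd) (uconvM uconv_id db))) => [|x]; last first.
    by rewrite mul0r addr0.
  near=> eps => x; have eps0 : eps != 0 by near: eps; apply: nbhs_dnbhs_neq.
  by rewrite mulVKf // addrC subrK.
elim/mpoly_ring_ind: a => [c|j|a b [qa da] [qb db]|a b [qa da] [qb db]].
- have [B B0 cB] := horner_disc_bounded c.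
  have bd : exists2 B, 0 <= B & forall x, `|evqh q (hh x) c%:MP| <= B.
    by exists B => // x; rewrite evqhC; apply: cB.
  split.
    by apply: (near_uconv (cst _ bd)) => //; near=> eps => x; rewrite !evqhC.
  apply: (near_uconv (@uconv_cst _ _ _ _ _ (fun=> 0) 0 _)) => [x||x].
  + by rewrite normr0.
  + by near=> eps => x; rewrite !evqhC subrr mulr0.
  + by rewrite mderivC raddf0.
- have bd : exists2 B, 0 <= B & forall x, `|evqh q (hh x) 'X_j| <= B.
    by exists `|q 0 j| => // x; rewrite evqhX.
  suff db : uconv (0 : C)^' (fun eps x => eps^-1 *
        (evqh (shift eps) (hh x) 'X_j - evqh q (hh x) 'X_j))
      (fun x => evqh q (hh x) ('X_j : A)^`M(i)).
    split; last exact: db.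
    exact: (cvg_val _ bd db).
  apply: (near_uconv (@uconv_cst _ _ _ _ _ (fun=> (j == i)%:R) 1 _)) => [x||x].
  + by case: eqP; rewrite ?normr1 ?normr0.
  + near=> eps => x; have eps0 : eps != 0 by near: eps; apply: nbhs_dnbhs_neq.
    by rewrite !evqhX /shift !mxE eqxx /= addrAC subrr add0r mulKf.
  + rewrite mderivX evqhZ mnm1E -polyC_natr hornerC; case: eqP => [<-|_].
      rewrite (_ : (U_(j) - U_(j) = 0 :> 'X_{1..r})%MM); last first.
        by apply/mnmP => k; rewrite mnmBE subnn mnm0E.
      by rewrite mpolyX0 -mpolyC1 evqhC hornerC mulr1.
    by rewrite mul0r.
- split.
    apply: (near_uconv (uconvD qa qb)) => [|x]; last by rewrite rmorphD.
    by near=> eps => x; rewrite rmorphD.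
  apply: (near_uconv (uconvD da db)) => [|x]; last by rewrite mderivD rmorphD.
  near=> eps => x.
  by rewrite !rmorphD /= -mulrDr opprD addrACA.
- split.
    apply: (near_uconv (uconvM qa qb)) => [|x]; last by rewrite rmorphM.
    by near=> eps => x; rewrite rmorphM.
  have qa' := cst _ qa.1.
  apply: (near_uconv (uconvD (uconvM da qb) (uconvM qa' db))) => [|x]; last first.
    by rewrite mderivM rmorphD !rmorphM.
  near=> eps => x.
  rewrite !rmorphM /=; move: (eps^-1) (evqh (shift eps) _ a) (evqh q _ a).
  by move: (evqh (shift eps) _ b) (evqh q _ b) => vb wb e va wa; ring.
Unshelve. all: by end_near.
Qed.

End Derivative.

Lemma near_shift q i (U : set 'rV[C]_r) : open U -> U q ->
  \forall eps \near (0 : C)^', U (shift q i eps).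
Proof.
move=> oU Uq; apply: nbhs_dnbhs.
have cont : (fun eps : C => (q + eps *: delta_mx 0 i : 'rV[C]_r)) @ (0 : C) -->
    (q + 0 *: delta_mx 0 i : 'rV[C]_r).
  have cq : (fun _ : C => q) @ (0 : C) --> q.
    exact: (@cvg_cst 'rV[C]_r q C _ (nbhs_filter (0 : C))).
  apply: (cvgD cq).
  exact: (@scalel_continuous C 'rV[C]_r (delta_mx 0 i) 0).
by apply: cont; apply: open_nbhs_nbhs; rewrite scale0r addr0.
Qed.

Lemma horner_disc_eq0 (c : {poly C}) : (forall h, `|h| <= 1 -> c.[h] = 0) -> c = 0.
Proof.
move=> c0; apply/eqP; apply: contraT => c_neq0.
have := @max_poly_roots _ c [seq k.+1%:R^-1 : C | k <- iota 0 (size c)] c_neq0.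
rewrite size_map size_iota ltnn => -> //.
  apply/allP => _ /mapP[k _ ->]; rewrite /root c0 // ger0_norm ?invr_ge0 //.
  by rewrite invf_le1 ?ltr0n // ler1n.
rewrite map_inj_uniq ?iota_uniq // => x y /invr_inj/eqP.
by rewrite eqr_nat => /eqP [].
Qed.

(** The partial derivatives of [a] vanish on [U] as well and have smaller degree,
    so by induction they are zero, and [a] is constant in [q]. *)
Lemma evqh_open_eq0 (U : set 'rV[C]_r) a : open U -> U !=set0 ->
  (forall q h, U q -> `|h| <= 1 -> evqh q h a = 0) -> a = 0.
Proof.
move=> oU [q0 Uq0]; have [d] := ubnP (msize a); elim: d a => // d IHd a.
rewrite ltnS => sza a0.
have da i q h : U q -> `|h| <= 1 -> evqh q h a^`M(i) = 0.
  move=> Uq h1.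
  have [_ [_ lim]] := uconv_evqh (hh := fun _ : unit => h) q i (fun=> h1) a.
  apply/eqP; rewrite -normr_le0; apply/ler_addgt0Pr => e e0; rewrite add0r.
  near ((0 : C)^') => eps.
  have Us : U (shift q i eps) by near: eps; apply: near_shift.
  have : forall x : unit, `|eps^-1 * (evqh (shift q i eps) h a - evqh q h a)
      - evqh q h a^`M(i)| <= e by near: eps; apply: lim.
  by move=> /(_ tt); rewrite !a0 // subrr mulr0 sub0r normrN.
have da0 i : a^`M(i) = 0.
  have [->|nz] := eqVneq a 0; first exact: mderiv0.
  apply: IHd (da i); apply: leq_trans sza.
  have sz_gt0 : (0 < msize a)%N by rewrite lt0n msize_poly_eq0.
  rewrite -(prednK sz_gt0) ltnS msizeE; apply/bigmax_leqP_seq => m.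
  rewrite mcoeff_msupp mcoeff_mderiv => nzm _.
  have : (m + U_(i))%MM \in msupp a.
    by rewrite mcoeff_msupp; apply: contra_neq nzm => ->; rewrite mul0rn.
  by move=> /msize_mdeg_lt; rewrite mdegD mdeg1 addn1; case: (msize a).
have aC : a = (a@_0)%:MP.
  apply/mpolyP => m; rewrite mcoeffC; case: eqP => [<-|m0].
    by rewrite mulr1.
  rewrite mulr0; have [|i mi] := @mnm_neq0_ex _ m.
    by apply/eqP => mE; apply: m0; rewrite mE.
  have := congr1 (mcoeff (m - U_(i))%MM) (da0 i).
  rewrite mcoeff_mderiv mnm_subU1K // mcoeff0 -mulr_natl -polyC_natr => /eqP.
  by rewrite mulf_eq0 polyC_eq0 pnatr_eq0 => /eqP.
rewrite aC (_ : a@_0 = 0) ?mpolyC0 //; apply: horner_disc_eq0 => h h1.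
by rewrite -(evqhC q0) -aC a0.
Unshelve. all: by end_near.
Qed.

End Evaluation.

(** * Loops on the unit circle *)

Section Circle.
Import numFieldNormedType.Exports.
Local Open Scope classical_set_scope.
Variable R : realType.
Local Notation C := (Cx R).

Lemma normr_circle (x : R) : `|circle x : C| = 1.
Proof. by rewrite normc_def /= cos2Dsin2 sqrtr1. Qed.

Lemma circle_onto (z : C) : `|z| = 1 -> exists x, circle x = z.
Proof.
case: z => a b; rewrite normc_def /= => -[ab].
have ab1 : a ^+ 2 + b ^+ 2 = 1.
  by rewrite -[LHS]sqr_sqrtr ?addr_ge0 ?sqr_ge0 // ab expr1n.
have a1 : -1 <= a <= 1.
  rewrite -ler_norml -(@ler_pXn2r _ 2) ?nnegrE // expr1n.
  by rewrite real_normK ?num_real // -ab1 lerDl sqr_ge0.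
have cosa : cos (acos a) = a by rewrite acosK // in_itv.
have sina : sin (acos a) = `|b|.
  by rewrite sin_acos // -ab1 addrAC subrr add0r sqrtr_sqr.
have [b0|b0] := lerP 0 b.
  by exists (acos a); rewrite /circle cosa sina ger0_norm.
by exists (- acos a); rewrite /circle cosN sinN cosa sina ltr0_norm ?opprK.
Qed.

Lemma posC_real (e : C) : 0 < e -> exists2 t : R, 0 < t & e = t%:C%C.
Proof.
by case: e => a b; rewrite ltcE /= => /andP[/eqP -> a0]; exists a.
Qed.

(** A root [x] lies outside the disc and contributes a factor of absolute value
    at least [|x| - 1]. *)
Lemma horner_lower_bound (p : {poly C}) :
    (forall z, `|z| <= 1 -> p.[z] != 0) ->
  exists2 c, 0 < c & forall z, `|z| <= 1 -> c <= `|p.[z]|.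
Proof.
have [d] := ubnP (size p); elim: d p => // d IHd p; rewrite ltnS => szp p_neq0.
have [sz1|sz1] := eqVneq (size p) 1%N.
  exists `|p.[0]|; first by rewrite normr_gt0 p_neq0 ?normr0.
  by move=> z _; rewrite (size1_polyC (eq_leq sz1)) !hornerC.
have [x [p1 [x1 pE szp1 p1_neq0]]] := root_outside_disc p_neq0 sz1.
have [|c c0 pc] := IHd p1 _ p1_neq0; first exact: leq_trans szp1 szp.
exists (c * (`|x| - 1)); first by rewrite mulr_gt0 ?subr_gt0.
move=> z z1; rewrite pE hornerM normrM hornerXsubC.
apply: ler_pM; rewrite ?pc ?subr_ge0 ?(ltW c0) ?(ltW x1) //.
rewrite distrC; apply: le_trans (lerB_dist _ _).
by rewrite lerD2l lerN2.
Qed.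

(** The tails of the series are bounded, uniformly in [h], by those of the series
    of absolute values at [h = 1].  The form [h (f - B 0)] keeps track of the
    value [B 0] of [f] at infinity. *)
Lemma abs_sums_outer (B : nat -> C) (f : C -> C) :
    (forall h, 1 <= `|h| -> abs_sums_to (fun k => B k * h ^- k) (f h)) ->
  outer (fun h => h * (f h - B 0%N)).
Proof.
move=> fB e e0.
have e2 : 0 < e / 2%:R by rewrite divr_gt0.
have e4 : 0 < e / 2%:R / 2%:R by rewrite divr_gt0.
have [l Sl] : exists l : C, (fun n => \sum_(0 <= k < n) `|B k|) @ \oo --> l.
  have [/cvg_ex [l cvl] _] := fB 1 (eq_ind_r (fun x => 1 <= x) (lexx _) (normr1 _)).
  exists l; apply: cvg_trans cvl; apply: near_eq_cvg; near=> n.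
  by rewrite /series /=; apply: eq_bigr => k _; rewrite expr1n invr1 mulr1.
have /cvgrPdist_le /(_ _ e4) [N _ SN] := Sl.
exists (\poly_(k < N) B k.+1) => h h1.
have h_gt0 : 0 < `|h| by apply: lt_le_trans h1.
have h0 : h != 0 by rewrite -normr_gt0.
have [_ fh] := fB h h1.
have /cvgrPdist_le /(_ (e / 2%:R / `|h|)) := fh.
move=> /(_ (divr_gt0 e2 h_gt0)) [M _ sM].
pose s n := \sum_(0 <= k < n) B k * h ^- k.
pose m := maxn M N.+1.
have pE : (\poly_(k < N) B k.+1).[h^-1] = h * (s N.+1 - B 0%N).
  rewrite horner_poly /s big_nat_recl // expr0 invr1 mulr1 addrC addKr.
  rewrite mulr_sumr big_mkord; apply: eq_bigr => k _.
  by rewrite exprVn exprS invfM mulrCA [h * _]mulrA divff // mul1r.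
have -> : h * (f h - B 0%N) - (\poly_(k < N) B k.+1).[h^-1] =
    h * (f h - s m) + h * (s m - s N.+1) by rewrite pE; ring.
rewrite [e]splitr; apply: le_trans (ler_normD _ _) _; apply: lerD.
  rewrite normrM mulrC -ler_pdivlMr //; apply: sM.
  by rewrite /= /m leq_maxl.
have NM : (N.+1 <= m)%N by rewrite leq_maxr.
have -> : s m - s N.+1 = \sum_(N.+1 <= k < m) B k * h ^- k.
  by rewrite /s [X in X - _](big_cat_nat _ NM) //= addrAC subrr add0r.
apply: (@le_trans _ _ (\sum_(N.+1 <= k < m) `|B k|)).
  rewrite mulr_sumr; apply: le_trans (ler_norm_sum _ _ _) _.
  rewrite !big_nat; apply: ler_sum => -[|k] // _.
  rewrite mulrCA normrM ler_piMr // exprS invfM [h * _]mulrA divff // mul1r.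
  by rewrite -exprVn normrX normfV exprn_ile1 // invf_le1.
have S_ge0 : 0 <= \sum_(N.+1 <= k < m) `|B k| by apply: sumr_ge0.
rewrite -(ger0_norm S_ge0).
have -> : \sum_(N.+1 <= k < m) `|B k| =
    (l - \sum_(0 <= k < N.+1) `|B k|) - (l - \sum_(0 <= k < m) `|B k|).
  by rewrite [X in _ - (_ - X)](big_cat_nat _ NM) //=; ring.
rewrite [e / _]splitr; apply: le_trans (ler_normB _ _) _; apply: lerD.
  by apply: SN => /=.
by apply: SN; rewrite /= (leq_trans (leqnSn _)).
Unshelve. all: by end_near.
Qed.

Lemma minus_loop_outer n (c : C -> 'M[C]_n) : minus_loop c ->
  (forall h, 1 <= `|h| -> c h \in unitmx) /\
  forall a b, outer (fun h => h * (c h a b - (1%:M : 'M[C]_n) a b)).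
Proof.
case=> _ [B [B0 cB]]; split=> [h h1|a b]; first by have [] := cB h h1.
by rewrite -B0; apply: (abs_sums_outer (B := fun k => B k a b)) => h /cB[_]; apply.
Qed.

End Circle.

(** * The Birkhoff factorization of a solution *)

Section Birkhoff.
Import numFieldNormedType.Exports.
Local Open Scope classical_set_scope.
Variables (R : realType) (r n : nat).
Local Notation C := (Cx R).
Local Notation A := (coefRing R r).
Variables (hOm : 'I_r -> 'M[A]_n) (U : set 'rV[C]_r).
Variables (L Lm : 'rV[C]_r -> C -> 'M[C]_n) (X : 'M[A]_n).
Hypothesis oU : open U.
Hypothesis U_neq0 : forall q i, U q -> q 0 i != 0.
Hypothesis LP : forall q, U q -> dL_eq_LOmega hOm L q.
Hypothesis LmP : forall q, U q -> minus_loop (Lm q).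
Hypothesis XP : forall q h, U q -> `|h| <= 1 -> map_mx (evqh q h) X \in unitmx.
Hypothesis LE : forall q x, U q ->
  L q (circle x) = Lm q (circle x) *m map_mx (evqh q (circle x)) X.

Variables (q : 'rV[C]_r) (i : 'I_r).
Hypothesis Uq : U q.

Let shq := shift q i.

Lemma shift_norm (eps : C) : `|eps *: delta_mx 0 i : 'rV[C]_r| <= `|eps|.
Proof.
rewrite normrZ ler_piMr //.
have [->|] := eqVneq (delta_mx 0 i : 'rV[C]_r) 0; first by rewrite normr0 ler01.
move=> d0; have [|k kE] := @mx_norm_neq0 _ _ _ (delta_mx 0 i : 'rV[C]_r).
  by rewrite -[mx_norm _]/(`|delta_mx 0 i : 'rV[C]_r|) normr_eq0.
rewrite -[`|_|]/(mx_norm _) kE mxE; case: andP => _; by rewrite ?normr1 ?normr0 ?ler01.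
Qed.

Definition L_remainder (eps : C) (x : R) : 'M[C]_n :=
  L (shq eps) (circle x) - L q (circle x) -
  (eps / q 0 i) *: (L q (circle x) *m Omega hOm i q (circle x)).

Lemma muconv_L_remainder :
  muconv (0 : C)^' (fun eps x => eps^-1 *: L_remainder eps x) (fun=> 0).
Proof.
move=> a b; split; first by exists 0 => // x; rewrite mxE normr0.
move=> e /posC_real[t t0 ->].
have nearL := LP Uq 0%N t0.
near=> eps => x; rewrite [X in _ - X]mxE subr0.
have -> : (eps^-1 *: L_remainder eps x) a b = eps^-1 * L_remainder eps x a b.
  by rewrite mxE.
have eps0 : eps != 0 by near: eps; apply: nbhs_dnbhs_neq.
rewrite normrM normfV ler_pdivrMl ?normr_gt0 // [X in _ <= X]mulrC.
have t_ge0 : 0 <= t%:C%C :> C by rewrite lecR ltW.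
apply: le_trans _ (ler_wpM2l t_ge0 (shift_norm eps)).
have : forall (x : R) (a b : 'I_n),
  `|Defs.derivC 0 (fun y => (L (shq eps) (circle y) - L q (circle y)
           - \sum_k ((eps *: delta_mx 0 i : 'rV[C]_r) 0 k / q 0 k) *:
               (L q (circle y) *m Omega hOm k q (circle y))) a b) x|
      <= t%:C%C * `|eps *: delta_mx 0 i : 'rV[C]_r|.
  near: eps; apply: nbhs_dnbhs.
  have cont : (fun eps : C => eps *: delta_mx 0 i : 'rV[C]_r) @ (0 : C) -->
    (0 : 'rV[C]_r).
    have := @scalel_continuous C 'rV[C]_r (delta_mx 0 i) 0.
    by rewrite /continuous_at scale0r.
  exact: cont nearL.
have derivC0 (f : R -> C) y : Defs.derivC 0 f y = f y.
  by rewrite /Defs.derivC /= /reC /imC; case: (f y).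
move=> /(_ x a b); rewrite derivC0 (bigD1 i) //= big1 ?addr0 => [|k ki]; last first.
  by rewrite !mxE eqxx (negbTE ki) mulr0 mul0r scale0r.
by have -> : (eps *: delta_mx 0 i : 'rV[C]_r) 0 i = eps by rewrite !mxE !eqxx mulr1.
Unshelve. all: by end_near.
Qed.

Lemma muconv_evqh (M : 'M[A]_n) :
  muconv (0 : C)^' (fun eps x => map_mx (evqh (shq eps) (circle x)) M)
    (fun x : R => map_mx (evqh q (circle x)) M).
Proof.
move=> a b; have z1 (x : R) : `|circle x : C| <= 1 by rewrite normr_circle.
have [lim _] := uconv_evqh q i z1 (M a b).
by apply: (near_uconv lim) => [|x]; [near=> eps => x|]; rewrite mxE.
Unshelve. all: by end_near.
Qed.

Lemma muconv_hd (M : 'M[A]_n) :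
  muconv (0 : C)^' (fun eps x => (circle x * q 0 i) *: (eps^-1 *:
      (map_mx (evqh (shq eps) (circle x)) M - map_mx (evqh q (circle x)) M)))
    (fun x : R => map_mx (evqh q (circle x)) (map_mx (hd i) M)).
Proof.
move=> a b; have z1 (x : R) : `|circle x : C| <= 1 by rewrite normr_circle.
have [_ lim] := uconv_evqh q i z1 (M a b).
have zq : uconv (0 : C)^' (fun _ x => circle x * q 0 i) (fun x : R => circle x * q 0 i).
  by apply: (@uconv_cst _ _ _ _ _ _ `|q 0 i|) => x; rewrite normrM normr_circle mul1r.
apply: (near_uconv (uconvM zq lim)) => [|x]; last by rewrite !mxE evqh_hd.
by near=> eps => x; rewrite !mxE.
Unshelve. all: by end_near.
Qed.

Lemma muconv_cst (M : R -> 'M[C]_n) :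
    (forall a b, exists B, forall x, `|M x a b| <= B) ->
  muconv (0 : C)^' (fun _ x => M x) M.
Proof. by move=> bd a b; have [B MB] := bd a b; apply: uconv_cst MB. Qed.

Definition detq : {poly C} := evq q (\det X).
Definition numq : 'M[{poly C}]_n :=
  map_mx (evq q) ((X *m hOm i - map_mx (hd i) X) *m \adj X).

Lemma detq_neq0 z : `|z| <= 1 -> detq.[z] != 0.
Proof.
move=> z1; rewrite /detq horner_evq -det_map_mx -unitfE.
exact: XP.
Qed.

(** The approximants [Psi] are the difference quotients of [L_-] in the direction
    [q_i], times [h q_i]; they are outer because [L_-] is 1 at infinity for every
    [q].  Multiplied by [X] at the shifted point they equal [S], which only
    involves the difference quotients of [L] and [X] and therefore converges. *)
Lemma Lm_circle_limit : circle_limit (Lm q) detq numq.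
Proof.
have [Lm_unit outG] := minus_loop_outer (LmP Uq).
pose z (x : R) : C := circle x.
pose XE eps x := map_mx (evqh (shq eps) (z x)) X.
pose Xq x := map_mx (evqh q (z x)) X.
pose Aq x := map_mx (evqh q (z x)) (hOm i).
have LmB : muconv (0 : C)^' (fun _ x => Lm q (z x)) (fun x => Lm q (z x)).
  apply: muconv_cst => a b; have [B _ GB] := outer_bounded (outG a b).
  exists (B + `|(1%:M : 'M[C]_n) a b|) => x.
  rewrite -[Lm _ _ _ _](subrK ((1%:M : 'M[C]_n) a b)).
  apply: le_trans (ler_normD _ _) _; apply: lerD => //.
  by have := GB (z x); rewrite normrM normr_circle mul1r; apply.
have cstE (M : 'M[A]_n) : muconv (0 : C)^'
    (fun _ x => map_mx (evqh q (z x)) M) (fun x => map_mx (evqh q (z x)) M).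
  apply: muconv_cst => a b; have [[B _ MB] _] := muconv_evqh M a b.
  by exists B.
pose S eps x := (q 0 i * z x) *: (eps^-1 *: L_remainder eps x)
  + Lm q (z x) *m (Xq x *m Aq x +
      (-1 : C) *: ((z x * q 0 i) *: (eps^-1 *: (XE eps x - Xq x)))).
have limS : muconv (0 : C)^' S (fun x => Lm q (z x) *m
    map_mx (evqh q (z x)) (X *m hOm i - map_mx (hd i) X)).
  have qz : uconv (0 : C)^' (fun _ x => q 0 i * z x) (fun x : R => q 0 i * z x).
    by apply: (@uconv_cst _ _ _ _ _ _ `|q 0 i|) => x; rewrite normrM normr_circle mulr1.
  have m1 : uconv (0 : C)^' (fun _ _ => -1) (fun _ : R => -1 : C).
    by apply: (@uconv_cst _ _ _ _ _ _ `|-1|).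
  apply: (near_muconv (muconvD (muconvZ qz muconv_L_remainder) (muconvM LmB
    (muconvD (muconvM (cstE X) (cstE (hOm i))) (muconvZ m1 (muconv_hd X)))))) => [|x].
    by near=> eps.
  by rewrite scaler0 add0r map_mxB map_mxM scaleN1r.
pose Psi eps h := (q 0 i / eps) *: (h *: (Lm (shq eps) h - Lm q h)).
pose T eps x := (evqh (shq eps) (z x) (\det X))^-1 *:
  (S eps x *m map_mx (evqh (shq eps) (z x)) (\adj X)).
have detP eps x : U (shq eps) -> evqh (shq eps) (z x) (\det X) != 0.
  move=> Us; rewrite -det_map_mx -unitfE; apply: XP => //.
  by rewrite normr_circle.
have PsiE : \forall eps \near (0 : C)^', forall x, T eps x = Psi eps (z x).
  near=> eps => x.
  have eps0 : eps != 0 by near: eps; apply: nbhs_dnbhs_neq.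
  have Us : U (shq eps) by near: eps; apply: near_shift.
  have z0 : z x != 0 by rewrite -normr_gt0 normr_circle.
  have SE : S eps x = Psi eps (z x) *m XE eps x.
    rewrite /S /Psi /L_remainder !LE // -/(z x) -/(XE eps x) -/(Xq x).
    rewrite /Omega -/(z x) -/(Aq x) -!scalemxAr -!scalemxAl !mulmxBl.
    rewrite mulmxDr -!scalemxAr mulmxBr mulmxA.
    move: (Lm (shq eps) (z x) *m XE eps x) (Lm q (z x) *m XE eps x).
    move: (Lm q (z x) *m Xq x) => M1 M2 M3; move: (M1 *m Aq x) => M4.
    apply/matrixP => a b; rewrite !mxE.
    move: (M1 a b) (M2 a b) (M3 a b) (M4 a b) (q 0 i) (U_neq0 i Uq) => m1 m2 m3 m4 qi qi0.
    by field; rewrite eps0 z0 qi0.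
  rewrite /T SE -mulmxA -map_mxM mul_mx_adj.
  by rewrite map_scalar_mx mul_mx_scalar scalerA mulVf ?scale1r // detP.
have [c c0 pc] := horner_lower_bound detq_neq0.
have limdet : uconv (0 : C)^' (fun eps x => (evqh (shq eps) (z x) (\det X))^-1)
    (fun x => (evqh q (z x) (\det X))^-1).
  apply: (@uconvV _ _ _ _ _ _ _ c) => // [x|].
    by rewrite -horner_evq; apply: pc; rewrite normr_circle.
  by apply: (uconv_evqh q i _ _).1 => x; rewrite normr_circle.
have limPsi : muconv (0 : C)^' (fun eps x => Psi eps (z x))
  (fun x => (evqh q (z x) (\det X))^-1 *: (Lm q (z x) *m
     map_mx (evqh q (z x)) (X *m hOm i - map_mx (hd i) X) *m
     map_mx (evqh q (z x)) (\adj X))).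
  apply: (near_muconv (muconvZ limdet (muconvM limS (muconv_evqh (\adj X))))) => //.
have limdetPsi : muconv (0 : C)^' (fun eps x => detq.[z x] *: Psi eps (z x))
  (fun x => Lm q (z x) *m map_mx (evqh q (z x))
     ((X *m hOm i - map_mx (hd i) X) *m \adj X)).
  have [B _ dB] := horner_disc_bounded detq.
  have dd : uconv (0 : C)^' (fun _ x => detq.[z x]) (fun x : R => detq.[z x]).
    by apply: (@uconv_cst _ _ _ _ _ _ B) => x; apply: dB; rewrite normr_circle.
  apply: (near_muconv (muconvZ dd limPsi)) => [|x]; first by near=> eps.
  rewrite scalerA -horner_evq mulfV ?scale1r ?map_mxM ?mulmxA //.
  by apply: detq_neq0; rewrite normr_circle.
move=> e e0; near ((0 : C)^') => eps.
have Us : U (shq eps) by near: eps; apply: near_shift.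
exists (Psi eps); split=> [a b|h a b /circle_onto[x <-]].
  have [_ outGe] := minus_loop_outer (LmP Us).
  have := outerM (outerC (q 0 i / eps)) (outerD (outGe a b)
    (outerM (outerC (-1)) (outG a b))).
  by apply: eq_outer => h _; rewrite !mxE; ring.
have : forall a b x, `|(detq.[z x] *: Psi eps (z x)) a b - (Lm q (z x) *m
    map_mx (evqh q (z x)) ((X *m hOm i - map_mx (hd i) X) *m \adj X)) a b| <= e.
  near: eps; apply: filter_forall => a'; apply: filter_forall => b'.
  by have [_] := limdetPsi a' b'; apply.
move=> /(_ a b x); congr (`|_ - _| <= _); first by rewrite mxE.
rewrite mxE; apply: eq_bigr => j _; congr (_ * _).
by rewrite mxE [numq j b]mxE horner_evq.
Unshelve. all: by end_near.
Qed.

End Birkhoff.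

(** * The gauge equation over C[q,h] *)

Section GaugeEquation.
Import numFieldNormedType.Exports.
Local Open Scope classical_set_scope.
Variables (R : realType) (r n : nat).
Local Notation C := (Cx R).
Local Notation A := (coefRing R r).

Definition at_h0 : A -> A := map_mpoly (polyC \o horner_eval (0 : C)).
HB.instance Definition _ := GRing.RMorphism.on at_h0.

Lemma h_free_at_h0 a : h_free (at_h0 a).
Proof. by move=> m; rewrite mcoeff_map_mpoly size_polyC leq_b1. Qed.

Lemma evqh_at_h0 (q : 'rV[C]_r) h a : evqh q h (at_h0 a) = evqh q 0 a.
Proof.
elim/mpoly_ring_ind: a => [c|i|a b IHa IHb|a b IHa IHb].
- by rewrite /at_h0 map_mpolyC !evqhC hornerC.
- by rewrite /at_h0 map_mpolyX !evqhX.
- by rewrite !rmorphD /= IHa IHb.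
- by rewrite !rmorphM /= IHa IHb.
Qed.

Lemma at_h0_hd i a : at_h0 (hd i a) = 0.
Proof. by rewrite /at_h0 /hd map_mpolyZ /= /horner_eval hornerX polyC0 scale0r. Qed.

(** [liouville] gives [num i = F det X] with [F] free of [h] at each point of
    [U].  Eliminating [F] by means of the value at [h = 0] yields the polynomial
    identity [numE].  Its trace determines the logarithmic derivative of [det X],
    and once [det X = 1] no denominator is left. *)
Lemma birkhoff_gauge (hOm : 'I_r -> 'M[A]_n) (Q0 : 'rV[C]_r -> 'M[C]_n) :
    is_Q0 hOm Q0 ->
  exists (X : 'M[A]_n) (W : 'I_r -> 'M[A]_n),
  [/\ map_mx (mcoeff 0%MM) X = 1%:M,
      forall i, map_mx (hd i) X = X *m hOm i - W i *m X,
      forall i k l, h_free (W i k l), \det X = 1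
    & forall q, Q0 q = map_mx (evqh q 0) X].
Proof.
move=> [U [L [Lm [X [[oU U0 Uq0] [UL ULm LE X0 Q0E]]]]]].
pose num i := (X *m hOm i - map_mx (hd i) X) *m \adj X.
pose W i := map_mx at_h0 (num i).
pose d0 := at_h0 (\det X).
have XP q h : U q -> `|h| <= 1 -> map_mx (evqh q h) X \in unitmx.
  by move=> Uq h1; have [_ [_ [B XB]]] := ULm q Uq; have [] := XB h h1.
have numE i k l : d0 * num i k l = \det X * W i k l.
  apply/eqP; rewrite -subr_eq0; apply/eqP; apply: (evqh_open_eq0 oU U0) => q h Uq h1.
  have lim := @Lm_circle_limit R r n hOm U L Lm X oU Uq0
    (fun q Uq => (UL q Uq).2) (fun q Uq => (ULm q Uq).1) XP LE q i Uq.
  have [Lm_unit outG] := minus_loop_outer (ULm q Uq).1.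
  pose Gam h := h *: (Lm q h - 1%:M).
  have LmE z : 1 <= `|z| -> Lm q z = 1%:M + z^-1 *: Gam z.
    move=> z1; have z0 : z != 0 by rewrite -normr_gt0 (lt_le_trans ltr01).
    by rewrite /Gam scalerA mulVf // scale1r addrC subrK.
  have outGam a b : outer (fun z => Gam z a b).
    by apply: eq_outer (outG a b) => z _; rewrite !mxE.
  have [|F FE] := liouville Lm_unit LmE outGam _ lim.
    by move=> z z1; apply: (detq_neq0 XP Uq z1).
  have FEh z : evqh q z (num i k l) = F k l * evqh q z (\det X).
    have := congr1 (horner_eval z) (FE k l).
    by rewrite /horner_eval hornerZ /detq /numq [X in X.[z]]mxE !horner_evq.
  have WE : W i k l = at_h0 (num i k l) by rewrite mxE.
  rewrite rmorphB !rmorphM /= WE /d0 !evqh_at_h0.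
  have := (FEh h, FEh 0); move: (num i k l) => N [-> ->].
  by move: (evqh q 0 _) (evqh q h _) (F k l) => x y z; ring.
have det00 : (\det X)@_0%MM = 1 by rewrite -det_map_mx X0 det1.
have det_neq0 (u : A) : u@_0%MM = 1 -> u != 0.
  by move=> u0; apply: contraTneq (oner_neq0 {poly C}) => uE; rewrite -u0 uE mcoeff0 eqxx.
have d00 : d0@_0%MM = 1.
  by rewrite mcoeff_map_mpoly det00 /= /horner_eval hornerC.
have gauge i : d0 *: (X *m hOm i - map_mx (hd i) X) = W i *m X.
  have: \det X *: (d0 *: (X *m hOm i - map_mx (hd i) X)) = \det X *: (W i *m X).
    have numX : num i *m X = \det X *: (X *m hOm i - map_mx (hd i) X).
      by rewrite -mulmxA mul_adj_mx mul_mx_scalar.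
    have dnum : d0 *: num i = \det X *: W i.
      by apply/matrixP => k l; rewrite [LHS]mxE numE [RHS]mxE.
    move: numX dnum; move: (d0) (\det X) (num i) (W i) => d D N Wi.
    move: (_ - _) => G ND NW.
    by rewrite scalerA mulrC -scalerA -ND scalemxAl NW scalemxAl.
  move: (d0 *: _) (W i *m X) => G G' /matrixP eqX; apply/matrixP => k l.
  by apply: (mulfI (det_neq0 _ det00)); have := eqX k l; rewrite [LHS]mxE [RHS]mxE.
have detX : \det X = 1.
  apply: (hd_eigen_eq1 (g := fun i => \tr (hOm i) - at_h0 (\tr (hOm i)))) => // i.
  rewrite (derivation_det (@hdM R r i)).
  apply: (mulfI (det_neq0 _ d00)).
  have trW : \tr (W i) = at_h0 (\tr (hOm i)) * d0.
    (* The derivative term has a factor h and disappears at h = 0. *)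
    have tr0 : at_h0 (\tr (map_mx (hd i) X *m \adj X)) = 0.
      rewrite /mxtrace raddf_sum big1 // => k _; rewrite mxE raddf_sum big1 // => l _.
      by rewrite /= [at_h0 _]rmorphM mxE /= at_h0_hd mul0r.
    rewrite /W trace_map_mx /num mulmxBl !raddfB /=.
    transitivity (at_h0 (\tr (X *m hOm i *m \adj X)) - 0).
      by congr (_ - _).
    rewrite subr0 mxtrace_mulC mulmxA mul_adj_mx mul_scalar_mx mxtraceZ.
    by rewrite rmorphM mulrC.
  have trL : \tr ((X *m hOm i - map_mx (hd i) X) *m \adj X) =
      \det X * \tr (hOm i) - \tr (map_mx (hd i) X *m \adj X).
    rewrite mulmxBl raddfB /=; congr (_ - _).
    by rewrite mxtrace_mulC mulmxA mul_adj_mx mul_scalar_mx mxtraceZ.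
  have trR : \tr (W i *m X *m \adj X) = \det X * \tr (W i).
    by rewrite -mulmxA mul_mx_adj mul_mx_scalar mxtraceZ.
  have : d0 * \tr ((X *m hOm i - map_mx (hd i) X) *m \adj X) =
      \tr (W i *m X *m \adj X).
    by rewrite -gauge -mxtraceZ scalemxAl.
  have solve (t D a b d : A) : d * (D * a - t) = D * (b * d) ->
      d * t = d * (D * (a - b)).
    move=> E; transitivity (d * (D * a) - d * (D * a - t)); first by ring.
    by rewrite E; ring.
  move=> trG; apply: solve.
  exact: etrans (congr1 (fun u => d0 * u) (esym trL))
    (etrans trG (etrans trR (congr1 (fun u => \det X * u) trW))).
exists X, W; split=> //.
- move=> i; have := gauge i; rewrite /d0 detX rmorph1 scale1r => <-.
  by rewrite opprB addrC subrK.
- by move=> i k l; rewrite mxE; apply: h_free_at_h0.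
Qed.

End GaugeEquation.

(** * Change of basis of the module *)

Section ChangeOfBasis.
Variables (R : realType) (r : nat).
Local Notation C := (Cx R).
Local Notation A := (coefRing R r).
Local Notation D := (Dh R r).

Lemma opE (Z : D) d (f : A) : (msize Z <= d)%N ->
  op Z f = \sum_(k : 'X_{1..r < d}) Z@_k * hd_mon k f.
Proof.
pose I : subFinType _ := 'X_{1..r < d}.
move=> le_Zd; rewrite /op (ssrcomplements.big_mksub I) /=; first last.
- by move=> k /msize_mdeg_lt/leq_trans/(_ le_Zd).
- by rewrite msupp_uniq.
by rewrite big_rmcond //= => k /memN_msupp_eq0 ->; rewrite mul0r.
Qed.

Lemma opD (Z Z' : D) f : op (Z + Z') f = op Z f + op Z' f.
Proof.
pose d := maxn (msize (Z + Z')) (maxn (msize Z) (msize Z')).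
rewrite !(@opE _ d) ?leq_max ?leqnn ?orbT // -big_split /=.
by apply: eq_bigr => k _; rewrite mcoeffD mulrDl.
Qed.

Lemma opZ (a : A) (Z : D) f : op (a *: Z) f = a * op Z f.
Proof.
pose d := maxn (msize (a *: Z)) (msize Z).
rewrite !(@opE _ d) ?leq_max ?leqnn ?orbT // mulr_sumr.
by apply: eq_bigr => k _; rewrite mcoeffZ mulrA.
Qed.

Lemma op0 f : op (0 : D) f = 0.
Proof. by rewrite /op msupp0 big_nil. Qed.

Lemma op_sum n (Z : 'I_n -> D) f : op (\sum_i Z i) f = \sum_i op (Z i) f.
Proof.
by apply: (big_morph (fun Z => op Z f)) => [Z1 Z2|]; rewrite ?opD ?op0.
Qed.

Lemma hd_scalarA i c (f : A) : hd i (scalarA r c * f) = scalarA r c * hd i f.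
Proof. by rewrite /scalarA !mul_mpolyC hdZ. Qed.

Lemma hd_mon_linear k c (f g : A) :
  hd_mon k (scalarA r c * f + g) = scalarA r c * hd_mon k f + hd_mon k g.
Proof.
rewrite /hd_mon; elim: (enum 'I_r) => //= i s -> .
by elim: (k i) => //= d ->; rewrite raddfD /= hd_scalarA.
Qed.

(** Elements of [D^h] commute with complex constants, though not with the
    coefficient ring. *)
Lemma op_linear (Z : D) c f g :
  op Z (scalarA r c * f + g) = scalarA r c * op Z f + op Z g.
Proof.
rewrite /op mulr_sumr -big_split; apply: eq_bigr => k _.
by rewrite hd_mon_linear mulrDr mulrCA.
Qed.

Lemma op_arg0 (Z : D) : op Z 0 = 0.
Proof.
have := op_linear Z 1 0 0; rewrite mulr0 addr0 /scalarA mpolyC1 mul1r => /eqP.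
by rewrite -subr_eq0 opprD addNKr oppr_eq0 => /eqP.
Qed.

Lemma op_lincomb (Z : D) n (c : 'I_n -> C) (f : 'I_n -> A) :
  op Z (\sum_l scalarA r (c l) * f l) = \sum_l scalarA r (c l) * op Z (f l).
Proof.
elim: (index_enum 'I_n) => [|l s IHs]; first by rewrite !big_nil op_arg0.
by rewrite !big_cons op_linear IHs.
Qed.

Variable ops : 'I_r -> D.

Lemma in_left_idealD F F' : in_left_ideal ops F -> in_left_ideal ops F' ->
  in_left_ideal ops (fun f => F f + F' f).
Proof.
move=> [a FE] [a' FE']; exists (fun i => a i + a' i) => f.
by rewrite FE FE' -big_split; apply: eq_bigr => i _; rewrite opD.
Qed.

Lemma in_left_idealZ (c : A) F : in_left_ideal ops F ->
  in_left_ideal ops (fun f => c * F f).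
Proof.
move=> [a FE]; exists (fun i => c *: a i) => f.
by rewrite FE mulr_sumr; apply: eq_bigr => i _; rewrite opZ.
Qed.

Lemma in_left_ideal0 : in_left_ideal ops (fun=> 0).
Proof. by exists (fun=> 0) => f; rewrite big1 // => i _; rewrite op0. Qed.

Lemma in_left_ideal_sum n (F : 'I_n -> A -> A) :
  (forall l, in_left_ideal ops (F l)) -> in_left_ideal ops (fun f => \sum_l F l f).
Proof.
move=> FI; elim: (index_enum 'I_n) => [|l s IHs].
  by have [a aE] := in_left_ideal0; exists a => f; rewrite big_nil; apply: aE.
have [a aE] := in_left_idealD (FI l) IHs.
by exists a => f; rewrite big_cons; apply: aE.
Qed.

(** Both products express the classes of [h d_i P'_j] in the basis [P].  Their
    difference gives an expression of 0, and such an expression is unique. *)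
Lemma connection_change_basis n (P P' : 'I_n -> D) (M : 'M[C]_n)
    (hOm hOm' : 'I_r -> 'M[A]_n) :
    Mh_basis ops P -> connection_matrices ops P hOm ->
    (forall i, P' i = \sum_j scalarA r (M j i) *: P j) ->
    connection_matrices ops P' hOm' ->
  forall i, map_mx (scalarA r) M *m hOm' i = hOm i *m map_mx (scalarA r) M.
Proof.
move=> basisP hOmP P'E hOm'P i; apply/matrixP => k0 j; apply/eqP.
pose MA := map_mx (scalarA r) M.
pose a : 'rV[A]_n := \row_k ((hOm i *m MA) k j - (MA *m hOm' i) k j).
have [a0 [_ uniq]] := basisP 0.
have opP' f k : op (P' k) f = \sum_l scalarA r (M l k) * op (P l) f.
  by rewrite P'E op_sum; apply: eq_bigr => l _; rewrite opZ.
have aI : in_left_ideal ops (fun f => op 0 f - \sum_k a 0 k * op (P k) f).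
  have [b bE] := in_left_idealD
    (in_left_ideal_sum (fun l => in_left_idealZ (scalarA r (M l j)) (hOmP i l)))
    (in_left_idealZ (-1) (hOm'P i j)).
  exists b => f; rewrite -bE op0 sub0r opP' op_lincomb mulN1r opprB.
  under [X in _ = X + _]eq_bigr do rewrite mulrBr.
  rewrite sumrB addrC addrA subrK -[RHS]opprB; congr (- _).
  have -> : \sum_k hOm' i k j * op (P' k) f = \sum_l (MA *m hOm' i) l j * op (P l) f.
    under eq_bigr do rewrite opP' mulr_sumr; rewrite exchange_big.
    apply: eq_bigr => l _; rewrite mxE mulr_suml; apply: eq_bigr => k _.
    by rewrite mxE; ring.
  have -> : \sum_l scalarA r (M l j) * (\sum_k hOm i k l * op (P k) f) =
      \sum_k (hOm i *m MA) k j * op (P k) f.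
    under eq_bigr do rewrite mulr_sumr; rewrite exchange_big.
    apply: eq_bigr => l _; rewrite mxE mulr_suml; apply: eq_bigr => k _.
    by rewrite mxE; ring.
  by rewrite -sumrB; apply: eq_bigr => k _; rewrite mxE mulrBl.
have zI : in_left_ideal ops (fun f => op 0 f - \sum_k (0 : 'rV[A]_n) 0 k * op (P k) f).
  have [b bE] := in_left_ideal0; exists b => f.
  by rewrite -bE op0 big1 ?subrr // => k _; rewrite mxE mul0r.
have : a = 0 by rewrite -(uniq _ aI) -(uniq _ zI).
move/matrixP => /(_ 0 k0); rewrite [LHS]mxE [RHS]mxE => /eqP.
by rewrite subr_eq0 eq_sym.
Qed.

End ChangeOfBasis.

(** * Constant matrices *)

Section Constants.
Variables (R : realType) (r : nat).
Local Notation C := (Cx R).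
Local Notation A := (coefRing R r).

Lemma scalarA_is_additive : additive (@scalarA R r).
Proof. by move=> c d; rewrite /scalarA polyCB mpolyCB. Qed.

Lemma scalarA_is_monoid_morphism : monoid_morphism (@scalarA R r).
Proof. by split=> [|c d]; rewrite /scalarA ?polyC1 ?mpolyC1 // polyCM mpolyCM. Qed.

HB.instance Definition _ :=
  GRing.isZmodMorphism.Build C A (@scalarA R r) scalarA_is_additive.
HB.instance Definition _ :=
  GRing.isMonoidMorphism.Build C A (@scalarA R r) scalarA_is_monoid_morphism.

Lemma evqh_scalarA (q : 'rV[C]_r) h c : evqh q h (scalarA r c) = c.
Proof. by rewrite /scalarA evqhC hornerC. Qed.

Lemma mcoeff0_scalarA c : (scalarA r c : A)@_0%MM = c%:P.
Proof. by rewrite /scalarA mcoeffC eqxx mulr1. Qed.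

Lemma h_freeD (a b : A) : h_free a -> h_free b -> h_free (a + b).
Proof.
move=> ha hb m; rewrite mcoeffD (leq_trans (size_polyD _ _)) //.
by rewrite geq_max ha hb.
Qed.

Lemma h_free_sum n (a : 'I_n -> A) : (forall i, h_free (a i)) -> h_free (\sum_i a i).
Proof.
move=> ha; elim: (index_enum 'I_n) => [m|i s IHs].
  by rewrite big_nil mcoeff0 size_poly0.
by rewrite big_cons; apply: h_freeD.
Qed.

Lemma h_free_scalarA c (a : A) : h_free a -> h_free (scalarA r c * a).
Proof.
move=> ha m; rewrite /scalarA mcoeffCM mul_polyC.
exact: leq_trans (size_scale_leq _ _) _.
Qed.

Section ConstantMatrices.
Variables (n : nat) (M : 'M[C]_n) (N : 'M[A]_n).
Local Notation MA := (map_mx (@scalarA R r) M).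

Let hd_sum i (F : 'I_n -> A) : hd i (\sum_j F j) = \sum_j hd i (F j).
Proof. exact: raddf_sum. Qed.

Lemma hd_mul_constl i : map_mx (hd i) (MA *m N) = MA *m map_mx (hd i) N.
Proof.
apply/matrixP => k l; rewrite mxE [in LHS]mxE [RHS]mxE hd_sum.
by apply: eq_bigr => j _; rewrite !mxE hd_scalarA.
Qed.

Lemma hd_mul_constr i : map_mx (hd i) (N *m MA) = map_mx (hd i) N *m MA.
Proof.
apply/matrixP => k l; rewrite mxE [in LHS]mxE [RHS]mxE hd_sum.
by apply: eq_bigr => j _; rewrite !mxE mulrC hd_scalarA mulrC.
Qed.

Hypothesis freeN : forall k l, h_free (N k l).

Lemma h_free_mul_constl k l : h_free ((MA *m N) k l).
Proof.
by rewrite mxE; apply: h_free_sum => j; rewrite [MA _ _]mxE; apply/h_free_scalarA/freeN.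
Qed.

Lemma h_free_mul_constr k l : h_free ((N *m MA) k l).
Proof.
rewrite mxE; apply: h_free_sum => j; rewrite [MA _ _]mxE mulrC.
exact/h_free_scalarA/freeN.
Qed.

End ConstantMatrices.

End Constants.


Lemma conj_gauge (S : comNzRingType) n (M N X a W : 'M[S]_n) : N *m M = 1%:M ->
  M *m (X *m a - W *m X) *m N =
  (M *m X *m N) *m (M *m a *m N) - (M *m W *m N) *m (M *m X *m N).
Proof.
move=> NM; rewrite mulmxBr mulmxBl !mulmxA; congr (_ - _).
  by rewrite -(mulmxA _ N M) NM mulmx1.
by rewrite -(mulmxA _ N M) NM mulmx1.
Qed.

Theorem corollary4p2 (R : realType) (r s : nat) (G : flagData R r)
  (inv : 'I_r -> {mpoly (Cx R)[r]})
  (inv_basic : basic_invariants G inv)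
  (dimH : coh_dim inv s.+1)
  (ops : 'I_r -> Dh R r)
  (ops_toda : forall i, toda_operator G (inv i) (ops i))
  (m : 'I_s.+1 -> 'X_{1..r})
  (m_standard : standard_monomials ops m)
  (P : 'I_s.+1 -> Dh R r) (P_def : forall i, P i = 'X_[m i])
  (P_basis : Mh_basis ops P)
  (hOm : 'I_r -> 'M[coefRing R r]_s.+1)
  (hOm_def : connection_matrices ops P hOm)
  (Q0 : 'rV[Cx R]_r -> 'M[Cx R]_s.+1) (Q0_def : is_Q0 hOm Q0)
  (Cm : 'M[Cx R]_s.+1) (Cm_unit : Cm \in unitmx)
  (P' : 'I_s.+1 -> Dh R r)
  (P'_def : forall i, P' i = \sum_j scalarA r (Cm j i) *: P j)
  (hOm' : 'I_r -> 'M[coefRing R r]_s.+1)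
  (hOm'_def : connection_matrices ops P' hOm')
  (Q0' : 'rV[Cx R]_r -> 'M[Cx R]_s.+1) (Q0'_def : is_Q0 hOm' Q0')
  (c c' : 'I_s.+1 -> {mpoly (Cx R)[r]})
  (c_def : forall i, c i = 'X_[m i])
  (c'_def : forall i, c' i = \sum_j Cm j i *: c j)
  (q : 'rV[Cx R]_r) :
  [/\ Q0 q \in unitmx, Q0' q \in unitmx,
      Cm *m invmx (Q0' q) = invmx (Q0 q) *m Cm
    & forall i, coh_eq inv (\sum_j invmx (Q0' q) j i *: c' j)
                           (\sum_k (Cm *m invmx (Q0' q)) k i *: c k)].
Proof.
have [X [W [X0 eqX freeW detX Q0E]]] := birkhoff_gauge Q0_def.
have [X' [W' [X'0 eqX' freeW' detX' Q0'E]]] := birkhoff_gauge Q0'_def.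
have MA_hOm := connection_change_basis P_basis hOm_def P'_def hOm'_def.
pose MA := map_mx (@scalarA R r) Cm; pose NA := map_mx (@scalarA R r) (invmx Cm).
have MNA : MA *m NA = 1%:M by rewrite -map_mxM mulmxV // map_mx1.
have NMA : NA *m MA = 1%:M by rewrite -map_mxM mulVmx // map_mx1.
(* The solution of the second problem, transported to the basis P. *)
pose Y := MA *m X' *m NA.
have eqY i : map_mx (hd i) Y = Y *m hOm i - (MA *m W' i *m NA) *m Y.
  have hOmE : hOm i = MA *m hOm' i *m NA by rewrite MA_hOm -mulmxA MNA mulmx1.
  by rewrite /Y hd_mul_constr hd_mul_constl eqX' hOmE; apply: conj_gauge.
have Y0 : map_mx (mcoeff 0%MM) Y = 1%:M.
  rewrite /Y !map_mxM X'0 mulmx1 -map_mxM MNA map_mx1 //.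
have XY : X = Y.
  apply: (h_free_gauge_unique eqX eqY) => // i k l.
  exact/h_free_mul_constr/h_free_mul_constl/freeW'.
have unitQ M : \det M = 1 -> map_mx (evqh q 0) M \in unitmx.
  by move=> detM; rewrite unitmxE det_map_mx detM rmorph1 unitr1.
have uQ : Q0 q \in unitmx by rewrite Q0E unitQ.
have uQ' : Q0' q \in unitmx by rewrite Q0'E unitQ.
have QC : Q0 q *m Cm = Cm *m Q0' q.
  have ev (M : 'M[Cx R]_s.+1) : map_mx (evqh q 0) (map_mx (@scalarA R r) M) = M.
    by apply/matrixP => k l; rewrite !mxE evqh_scalarA.
  rewrite Q0E Q0'E XY /Y !map_mxM !ev -mulmxA mulVmx //.
  by rewrite mulmx1.
split=> //.
  by apply: (canRL (mulKmx uQ)); rewrite mulmxA QC mulmxK.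
move=> i; exists (fun=> 0); rewrite [RHS]big1 => [|j _]; last by rewrite mul0r.
apply/eqP; rewrite subr_eq0; apply/eqP.
under eq_bigr do rewrite c'_def scaler_sumr.
rewrite exchange_big; apply: eq_bigr => k _.
rewrite mxE scaler_suml; apply: eq_bigr => j _.
by rewrite scalerA mulrC.
Qed.
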